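(* Let $\alpha\in(0,1]$, $N:=\lfloor1/\alpha\rfloor$, $T>0$, let $\mathbb X$ be an $\alpha$-branched rough path lift on $[0,T]$ of $X\in\mathcal C^\alpha([0,T],\mathbb R^d)$, and let $\sigma=(\sigma_1,\dots,\sigma_d)\in C^{N-1}(\mathbb R^n,\mathbb R^n\otimes(\mathbb R^d)^* )$. Assume that $\Upsilon_\tau$ is globally Lipschitz continuous for all $\tau\in\mathcal T^{\le N}$. Let $Z$ be a Davie solution of $\dot Z_t=\sum_{i=1}^d\sigma_i(Z_t)\dot X^i_t$. Then for all $\tau_0\in\mathcal T^{\le N}$ there exists a function $H_{st}(\cdot;\tau_0):\mathcal F^{\le N-|\tau_0|}\to\mathbb R^n\otimes(\mathbb R^n)^*$ (for $0\le s\le t\le T$) such that for $0\le m\le N-|\tau_0|$ $$B^{[m+1]}_{st}(\tau_0)=\sum_{w\in\mathcal F^{\le m}}H_{st}(w;\tau_0)\cdot Z_{st}^{[m+1-|w|]}\,\mathbb X_{st}(w),$$ where $$B^{[m+1]}_{st}(\tau_0):=\Upsilon_{\tau_0}(Z_t)-\sum_{w\in\mathcal F^{\le m}}\frac{\Upsilon_{w\curvearrowright\tau_0}(Z_s)}{\pi(w)}\,\mathbb X_{st}(w),$$ the $Z^{[i]}$ are the solution remainders, and $$|H_{st}(w;\tau_0)|\lesssim\prod_{\tau\in\mathcal T^{\le|w|+|\tau_0|}}\|\nabla\Upsilon_\tau\|_\infty .$$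
   Context: Notation. $A\lesssim B$ means $A\le cB$ for a constant $c$. Trees. $\mathcal T$ is the set of finite non-planar rooted trees with vertices decorated by $\{1,\dots,d\}$; $|\tau|$ is the number of vertices. $\mathcal F$ is the set of forests, i.e. finite commutative products (multisets) of trees, including the empty forest $\mathbf 1$; $|w|$ is the total number of vertices. $\mathcal T^{\le m},\mathcal F^{\le m}$ are the subsets of elements with at most $m$ vertices. $[w]_i$ is the tree obtained by joining the roots of the trees of $w$ to a new root decorated by $i$; $\bullet_i=[\mathbf 1]_i$. If $w=\tau_1^{n_1}\cdots\tau_k^{n_k}$ with distinct $\tau_i$, $\pi(w):=\prod_i n_i!$. Grafting. $\tau\curvearrowright\mathbf 1=0$, $\tau\curvearrowright[w]_i=[\tau w+\tau\curvearrowright w]_i$, $\tau\curvearrowright(\tau_1\cdots\tau_k)=\sum_i\tau_1\cdots(\tau\curvearrowright\tau_i)\cdots\tau_k$ (everything extended linearly), and (Guin-Oudom) $\mathbf 1\curvearrowright\tau=\tau$, $(\tau_1\cdots\tau_k)\curvearrowright\tau=\tau_1\curvearrowright((\tau_2\cdots\tau_k)\curvearrowright\tau)-(\tau_1\curvearrowright(\tau_2\cdots\tau_k))\curvearrowright\tau$. Elementary differentials. $\Upsilon_{\bullet_j}=\sigma_j:\mathbb R^n\to\mathbb R^n$, $\Upsilon_{[\tau_1\cdots\tau_k]_j}=\nabla^k\sigma_j\cdot[\Upsilon_{\tau_1}\cdots\Upsilon_{\tau_k}]=\sum_{i_1,\dots,i_k}\partial_{i_1}\cdots\partial_{i_k}\sigma_j\,\Upsilon_{\tau_1}^{i_1}\cdots\Upsilon_{\tau_k}^{i_k}$,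 extended linearly to linear combinations of trees. Branched rough path. A family of maps $\mathbb X_{st}:\mathcal F^{\le N}\to\mathbb R$, $0\le s\le t\le T$, with $\mathbb X_{st}(\mathbf 1)=1$, $\mathbb X_{st}(\tau_1\cdots\tau_k)=\prod_i\mathbb X_{st}(\tau_i)$, $|\mathbb X_{st}(\tau)|\lesssim|t-s|^{|\tau|\alpha}$ uniformly in $0\le s\le t\le T$ for $\tau\in\mathcal T^{\le N}$, and Chen's relation, which (by multiplicativity) reads: for $s\le u\le t$, $\tau\in\mathcal T^{\le N}$, $\mathbb X_{st}(\tau)=\mathbb X_{su}(\tau)+\sum_{w\in\mathcal F,\rho\in\mathcal T}\frac{\mathbb X_{su}(w)}{\pi(w)}\mathbb X_{ut}(\rho)\langle w\curvearrowright\rho,\tau\rangle$, where $\langle w\curvearrowright\rho,\tau\rangle$ is the coefficient of $\tau$ in $w\curvearrowright\rho$. It is a lift of $X$ if $\mathbb X_{st}(\bullet_i)=X^i_t-X^i_s$. Davie solution: a map $Z:[0,T]\to\mathbb R^n$ with $Z_t-Z_s-\sum_{\tau\in\mathcal T^{\le N}}\Upsilon_\tau(Z_s)\mathbb X_{st}(\tau)=o(t-s)$ uniformly for $0\le s\le t\le T$. Solution remainders: $Z^{[m+1]}_{st}:=Z_t-Z_s-\sum_{\tau\in\mathcal T^{\le m}}\Upsilon_\tau(Z_s)\mathbb X_{st}(\tau)$, $m\ge0$.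
   Formalization: In the bound on H, factors ‖∇Υ_τ‖_∞ equal to 0 are left out of the product, since the literal bound fails then (α=1, σ₁(x)=x, σ₂=1, X=(t,0), Z=e^t, τ₀=•₁); the constant in ≲ may depend on σ, α, N, n, d, but not on T, X, 𝕏, Z, τ₀. *)

(* Defs.v *)
(* MathComp with MathComp-Analysis *)
From HB Require Import structures.
From mathcomp Require Import all_boot all_order all_algebra finmap multiset.
From mathcomp Require Import all_classical all_reals all_analysis.
From mathcomp.multinomials Require Import freeg.
From mathcomp Require Import zify.

Set Implicit Arguments.
Unset Strict Implicit.
Unset Printing Implicit Defensive.

Import Order.TTheory GRing.Theory Num.Theory.
Import numFieldNormedType.Exports.

Local Open Scope mset_scope.
Local Open Scope classical_set_scope.
Local Open Scope ring_scope.

(* Planar decorated rooted trees.  A non-planar tree is encoded as the planar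
   tree of its class (modulo permutation of branches) whose lists of branches
   are all sorted, see [to_tree_eq] below. *)
Inductive ptree (d : nat) := PNode of 'I_d & seq (ptree d).

Section PlanarTrees.
Variable d : nat.
Implicit Types (t u : ptree d) (l : seq (ptree d)).

Lemma ptree_ind' (P : ptree d -> Prop) :
  (forall i l, foldr (fun u => and (P u)) True l -> P (PNode i l)) ->
  forall t, P t.
Proof.
by move=> IH; fix F 1 => -[i l]; apply: IH; elim: l => [//|v l IHl]; split.
Qed.

Fixpoint ptree_encode t : GenTree.tree 'I_d :=
  let: PNode i l := t in
  GenTree.Node 0 (GenTree.Leaf i :: [seq ptree_encode u | u <- l]).

Fixpoint ptree_decode (g : GenTree.tree 'I_d) : option (ptree d) :=
  if g is GenTree.Node _ (GenTree.Leaf i :: s)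
  then Some (PNode i (pmap ptree_decode s)) else None.

Lemma ptree_encodeK : pcancel ptree_encode ptree_decode.
Proof.
elim/ptree_ind' => i l IH /=; congr (Some (PNode i _)).
by elim: l IH => [//|u l IHl] /= [-> /IHl ->].
Qed.

HB.instance Definition _ := Countable.copy (ptree d) (pcan_type ptree_encodeK).

Lemma ptree_indP (P : ptree d -> Prop) :
  (forall i l, {in l, forall u, P u} -> P (PNode i l)) -> forall t, P t.
Proof.
move=> IH; elim/ptree_ind' => i l IHl; apply: IH => u.
by elim: l IHl => [//|v l IHv] /= [Pv /IHv ?]; rewrite in_cons => /predU1P[->|].
Qed.

Fixpoint ptree_size t : nat := let: PNode _ l := t in (sumn [seq ptree_size u | u <- l]).+1.

Definition ptree_le t u : bool := (choice.pickle t <= choice.pickle u)%N.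

Lemma ptree_le_total : total ptree_le.
Proof. by move=> t u; exact: leq_total. Qed.

Lemma ptree_le_trans : transitive ptree_le.
Proof. by move=> t u v; exact: leq_trans. Qed.

Lemma ptree_le_anti : antisymmetric ptree_le.
Proof.
by move=> t u; rewrite -eqn_leq => /eqP/(pcan_inj (@choice.pickleK _)).
Qed.

Fixpoint pcanon t : ptree d :=
  let: PNode i l := t in PNode i (sort ptree_le [seq pcanon u | u <- l]).

Lemma pcanon_id t : pcanon (pcanon t) == pcanon t.
Proof.
apply/eqP; elim/ptree_indP: t => i l IH /=; congr PNode.
set s := sort _ (map _ l); have -> : [seq pcanon u | u <- s] = s.
  rewrite -[RHS]map_id; apply/eq_in_map => u.
  by rewrite mem_sort => /mapP[v vl ->]; exact: IH.
apply: sorted_sort; first exact: ptree_le_trans.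
by apply: sort_sorted; exact: ptree_le_total.
Qed.

(* Grafting of [t] on planar trees: the list (with multiplicity) of the trees
   obtained by attaching [t] as a new branch to a vertex of [u]. *)
Fixpoint pgraft t u : seq (ptree d) :=
  let: PNode i l := u in
  PNode i (t :: l) ::
  [seq PNode i l' | l' <-
    (fix in_branch l := if l is v :: l'
       then [seq v' :: l' | v' <- pgraft t v] ++ [seq v :: l'' | l'' <- in_branch l']
       else [::]) l].

End PlanarTrees.

Definition tree (d : nat) := {t : ptree d | pcanon t == t}.
HB.instance Definition _ d := [isSub of tree d for @sval _ _].
HB.instance Definition _ d := [Countable of tree d by <:].

Notation forest d := {mset tree d}.

Section Trees.
Variable d : nat.
Implicit Types (t u r : tree d) (w : forest d).

Definition to_tree (p : ptree d) : tree d := exist _ (pcanon p) (pcanon_id p).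

(* [w]_i *)
Definition bplus (i : 'I_d) w : tree d := to_tree (PNode i (map val (w : seq _))).

Definition tree_size t : nat := ptree_size (val t).
Definition forest_size w : nat := (\sum_(t <- w) tree_size t)%N.

(* pi(w) *)
Definition forest_sym w : nat := (\prod_(t <- finsupp w) (w t)`!)%N.

(* t \curvearrowright u, see [graft_bplus] below *)
Definition graft t u : {freeg (tree d) / int} :=
  \sum_(p <- pgraft (val t) (val u)) << to_tree p >>.

(* Guin-Oudom extension (ts_1 ... ts_k) \curvearrowright u by recursion on k;
   ts_1 \curvearrowright (ts_2 ... ts_k) is expanded by the Leibniz rule. *)
Fixpoint gograft_rec (k : nat) (ts : seq (tree d)) u : {freeg (tree d) / int} :=
  if k is k'.+1 then
    if ts is t :: ts' then
      fglift (graft t) (gograft_rec k' ts' u)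
      - \sum_(i < size ts')
          fglift (fun r => gograft_rec k' (set_nth t ts' i r) u)
                 (graft t (nth t ts' i))
    else << u >>
  else << u >>.

(* w \curvearrowright u; the result does not depend on the enumeration of the
   trees of w (Guin-Oudom). *)
Definition gograft w u : {freeg (tree d) / int} :=
  gograft_rec (size (w : seq _)) (w : seq _) u.

End Trees.

Section TreeFacts.
Variable d : nat.
Implicit Types (t u r : tree d) (w : forest d) (p q : ptree d).

Lemma to_tree_val t : to_tree (val t) = t.
Proof. by apply: val_inj => /=; apply/eqP; exact: (valP t). Qed.

Lemma to_tree_eq i j (l l' : seq (ptree d)) :
  (to_tree (PNode i l) == to_tree (PNode j l')) =
  (i == j) && perm_eq (map (@to_tree d) l) (map (@to_tree d) l').
Proof.
rewrite -val_eqE /=.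
have vE s : map val (map (@to_tree d) s) = map (@pcanon d) s by rewrite -map_comp.
apply/eqP/andP => [[-> /perm_sortP E]|[/eqP -> pll']].
  split=> //; have := E (@ptree_le_total d) (@ptree_le_trans d) (@ptree_le_anti d).
  by rewrite -!vE => /(perm_map_inj val_inj).
congr PNode; apply/perm_sortP.
- exact: ptree_le_total.
- exact: ptree_le_trans.
- exact: ptree_le_anti.
by rewrite -!vE; exact: perm_map.
Qed.

Lemma to_tree_bplus i (l : seq (ptree d)) :
  to_tree (PNode i l) = bplus i (seq_mset (map (@to_tree d) l)).
Proof.
apply/eqP; rewrite to_tree_eq eqxx /= -map_comp.
rewrite (eq_map (g := id)) => [|t]; last exact: to_tree_val.
by rewrite map_id perm_sym perm_eq_seq_mset.
Qed.

Lemma bplus_surj t : exists i w, t = bplus i w.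
Proof.
by rewrite -(to_tree_val t); case: (val t) => i l; exists i;
   eexists; exact: to_tree_bplus.
Qed.

Lemma bplus_inj i j w w' : bplus i w = bplus j w' -> i = j /\ w = w'.
Proof.
move/eqP; rewrite to_tree_eq -!map_comp => /andP[/eqP -> e]; split=> //.
move: e; rewrite !(eq_map (g := id)) => [|t|t]; [|exact: to_tree_val..].
by rewrite !map_id => /eq_seq_msetP; rewrite !seq_mset_id.
Qed.

Lemma ptree_size_pcanon p : ptree_size (pcanon p) = ptree_size p.
Proof.
elim/ptree_indP: p => i l IH /=; congr _.+1; rewrite !sumnE !big_map.
rewrite (perm_big _ (permEl (perm_sort _ _))) big_map.
by apply: eq_big_seq => q /IH.
Qed.

Lemma tree_size_bplus i w : tree_size (bplus i w) = (forest_size w).+1.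
Proof.
rewrite /tree_size [LHS]ptree_size_pcanon /= /forest_size sumnE big_map big_map.
by [].
Qed.

Lemma forest_sizeD1 t w :
  forest_size (t +` w) = (tree_size t + forest_size w)%N.
Proof.
rewrite /forest_size; transitivity (\sum_(u <- t :: (w : seq _)) tree_size u)%N; last first.
  by rewrite big_cons.
apply: perm_big; apply/eq_seq_msetP.
rewrite seq_mset_id; apply/msetP => u.
by rewrite mset1DE mset_seqE /= count_mem_mset eq_sym.
Qed.

Lemma fgliftB (f : tree d -> {freeg (tree d) / int}) :
  {morph fglift f : x y / x - y}.
Proof. exact: lift_is_additive. Qed.

Lemma fglift0 (f : tree d -> {freeg (tree d) / int}) : fglift f 0 = 0.
Proof. by rewrite -[X in fglift f X](subrr 0) fgliftB subrr. Qed.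

Lemma fgliftD (f : tree d -> {freeg (tree d) / int}) :
  {morph fglift f : x y / x + y}.
Proof.
move=> x y; rewrite -{1}[y]opprK fgliftB; congr (_ + _).
by rewrite -[- y]add0r fgliftB fglift0 sub0r opprK.
Qed.

Lemma fglift_sum (f : tree d -> {freeg (tree d) / int}) (J : Type) (s : seq J)
    (F : J -> {freeg (tree d) / int}) :
  fglift f (\sum_(j <- s) F j) = \sum_(j <- s) fglift f (F j).
Proof. exact: (big_morph _ (fgliftD f) (fglift0 f)). Qed.

Lemma graft_bplus t i w :
  graft t (bplus i w) = << bplus i (t +` w) >> +
    \sum_(u <- w) fglift (fun r => << bplus i (r +` (w `\ u)%mset) >>) (graft t u).
Proof.
pose s := map (@to_tree d) (sort (@ptree_le d) (map (@pcanon d) (map val (w : seq _)))).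
have sE : val (bplus i w) = PNode i (map val s).
  congr PNode; rewrite /s -[RHS]map_comp -[LHS]map_id.
  apply/eq_in_map => q.
  rewrite mem_sort => /mapP[p _ ->] /=; exact/esym/eqP/pcanon_id.
have sw : seq_mset s = w.
  rewrite -[RHS]seq_mset_id; apply/eq_seq_msetP.
  rewrite (perm_trans (perm_map _ (permEl (perm_sort _ _)))) //.
  rewrite -!map_comp (eq_map (g := id)) ?map_id // => u /=.
  by apply: val_inj => /=; apply/eqP; rewrite (eqP (pcanon_id _)); exact: (valP u).
have consE a (l : seq (tree d)) : seq_mset (a :: l) = a +` seq_mset l.
  by apply/msetP => b; rewrite mset1DE !mset_seqE /= eq_sym.
have tvK (l : seq (tree d)) : map (@to_tree d) (map val l) = l.
  by rewrite -map_comp -[RHS]map_id; apply: eq_map => a; exact: to_tree_val.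
rewrite /graft sE /= big_cons; congr (_ + _).
  by rewrite to_tree_bplus /= tvK to_tree_val consE sw.
rewrite big_map.
under eq_bigr do rewrite to_tree_bplus.
rewrite [RHS](perm_big s) /=; last by rewrite -sw perm_eq_seq_mset.
rewrite -sw; move: s {sE sw} => s; clear w.
pose G m : {freeg (tree d) / int} := << bplus i m >>.
suff H m : \sum_(l' <- (fix in_branch l := if l is v :: l'
       then [seq v' :: l' | v' <- pgraft (val t) v] ++ [seq v :: l'' | l'' <- in_branch l']
       else [::]) (map val s)) G (m `+` seq_mset (map (@to_tree d) l'))%mset =
    \sum_(u <- s) \sum_(q <- pgraft (val t) (val u))
      G (m `+` (to_tree q +` (seq_mset s `\ u)))%mset.
  apply: etrans (etrans _ (H mset0)) _; first by apply: eq_bigr => l' _; rewrite mset0D.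
  apply: eq_bigr => u _; rewrite fglift_sum; apply: eq_bigr => q _.
  by rewrite mset0D liftU scale1r.
elim: s m => [|v s IH] m /=; first by rewrite !big_nil.
rewrite big_cat /= big_cons !big_map; congr (_ + _).
  by apply: eq_bigr => q _; rewrite /= !consE tvK msetD1K.
under eq_bigr do rewrite consE to_tree_val [(v +` _)%mset]msetDC msetDA.
under eq_bigr do rewrite -msetDA [(seq_mset _ `+` _)%mset]msetDC msetDA.
rewrite IH; apply: eq_big_seq => u us; apply: eq_bigr => q _; congr G.
rewrite consE; apply/msetP => b; rewrite !(msetE2, mset1DE, msetB1E, msetnE).
have : (0 < seq_mset s u)%N by rewrite mset_seqE -has_count has_pred1.
by case: (b =P v) => [->|_]; case: (_ =P u) => [->|_];
  case: (_ == to_tree q) => /=; lia.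
Qed.

Lemma finite_seqs (T : Type) (A : set T) m : finite_set A ->
  finite_set [set s : seq T | (size s <= m)%N /\ forall i x0, (i < size s)%N -> A (nth x0 s i)].
Proof.
move=> fA; elim: m => [|m IH].
  by apply: (sub_finite_set (B := [set [::]])) => // s [/=]; case: s.
apply: (sub_finite_set (B := [set [::]] `|`
   (fun x => x.1 :: x.2) @` (A `*` [set s : seq T | (size s <= m)%N /\
      forall i x0, (i < size s)%N -> A (nth x0 s i)]))).
  move=> [|a s] [/= sm As]; [by left|right].
  exists (a, s) => //; split=> /=; first exact: (As 0 a).
  by split=> // i x0 si; exact: (As i.+1 x0).
rewrite finite_setU; split=> //; apply: finite_image; exact: finite_setX.
Qed.

Lemma finite_ptrees m : finite_set [set p : ptree d | (ptree_size p <= m)%N].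
Proof.
elim: m => [|m IH]; first by apply: (sub_finite_set (B := set0)) => // -[].
apply: (sub_finite_set (B := (fun x => PNode x.1 x.2) @` ([set: 'I_d] `*`
  [set s : seq (ptree d) | (size s <= m)%N /\ forall i x0, (i < size s)%N ->
    [set p : ptree d | (ptree_size p <= m)%N] (nth x0 s i)]))).
  move=> [i l] /=; rewrite ltnS => lm; exists (i, l) => //; split=> //=; split.
    apply: leq_trans lm; elim: l => //= -[j k] l IHl /=; lia.
  move=> k x0 kl; apply: leq_trans lm; rewrite sumnE big_map.
  by rewrite (big_nth x0) big_mkord (bigD1 (Ordinal kl)) //= leq_addr.
apply: finite_image; apply: finite_setX; first exact: finite_finset.
exact: finite_seqs.
Qed.

Lemma finite_trees m : finite_set [set t : tree d | (tree_size t <= m)%N].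
Proof.
apply: (sub_finite_set (B := @to_tree d @` [set p : ptree d | (ptree_size p <= m)%N])).
  by move=> t tm; exists (val t) => //; exact: to_tree_val.
exact/finite_image/finite_ptrees.
Qed.

Lemma tree_size_gt0 t : (0 < tree_size t)%N.
Proof. by rewrite /tree_size; case: (val t). Qed.

Lemma finite_forests m :
  finite_set [set w : forest d | (forest_size w <= m)%N].
Proof.
apply: (sub_finite_set (B := (fun s => seq_mset s : forest d) @`
  [set s : seq (tree d) | (size s <= m)%N /\ forall i x0, (i < size s)%N ->
    [set t : tree d | (tree_size t <= m)%N] (nth x0 s i)])); last first.
  by apply/finite_image/finite_seqs/finite_trees.
move=> w /= wm; exists w => /=; last exact: seq_mset_id.
split.
  apply: leq_trans wm; rewrite /forest_size -sum1_size.
  by apply: leq_sum => t _; exact: tree_size_gt0.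
move=> k x0 kl; apply: leq_trans wm; rewrite /forest_size.
by rewrite (big_nth x0) big_mkord (bigD1 (Ordinal kl)) //= leq_addr.
Qed.

(* Grafting preserves the number of vertices; hence the sum in Chen's relation
   has finitely many nonzero terms. *)
Let homog (k : nat) (D : {freeg (tree d) / int}) :=
  forall r, coeff r D != 0 -> tree_size r = k.

Let homogB k x y : homog k x -> homog k y -> homog k (x - y).
Proof.
move=> hx hy r; rewrite coeffB => h.
have [x0|] := eqVneq (coeff r x) 0; last exact: hx.
by apply: hy; apply: contra_neq h => y0; rewrite x0 y0 subr0.
Qed.

Let homog0 k : homog k 0.
Proof. by move=> r; rewrite coeff0 eqxx. Qed.

Let homogU k t : tree_size t = k -> homog k << t >>.
Proof. by move=> tk r; rewrite coeffU mul1r; case: (t =P r) => [<-|_] //; rewrite eqxx. Qed.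

Let homog_sum k (J : eqType) (s : seq J) (F : J -> {freeg (tree d) / int}) :
  (forall j, j \in s -> homog k (F j)) -> homog k (\sum_(j <- s) F j).
Proof.
move=> h; rewrite big_seq; elim/big_ind: _ => // x y hx hy.
by rewrite -[y]opprK; apply: homogB => //; rewrite -[- y]sub0r; apply: homogB.
Qed.

Let homog_fglift k (f : tree d -> {freeg (tree d) / int}) D :
  (forall r, r \in dom D -> homog k (f r)) -> homog k (fglift f D).
Proof.
move=> h; rewrite -[D in fglift f D]freeg_sumE fglift_sum.
apply: homog_sum => j jD r; rewrite liftU coeffZ => cr; apply: (h j jD).
by apply: contra_neq cr => c0; rewrite c0 mulr0.
Qed.

Let ptree_size_pgraft p q q' :
  q' \in pgraft p q -> ptree_size q' = (ptree_size p + ptree_size q)%N.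
Proof.
elim/ptree_indP: q q' => i l IH q' /=; rewrite in_cons => /predU1P[->|] /=.
  by rewrite addnS.
case/mapP => l' l'P ->; rewrite /= addnS; congr _.+1.
elim: l IH l' l'P => [//|v l IHl] IH l'; rewrite mem_cat => /orP[] /mapP[v' v'P ->] /=.
  by rewrite (IH v) ?mem_head // addnA.
rewrite (IHl _ v') //; first exact: addnCA.
move=> u ul; apply: IH.
by rewrite in_cons ul orbT.
Qed.

Let homog_graft t u : homog (tree_size t + tree_size u) (graft t u).
Proof.
apply: homog_sum => q qP; apply: homogU.
by rewrite /tree_size [LHS]ptree_size_pcanon (ptree_size_pgraft qP).
Qed.

Lemma tree_size_gograft w u r : coeff r (gograft w u) != 0 ->
  tree_size r = (forest_size w + tree_size u)%N.
Proof.
rewrite /gograft /forest_size -[in X in (X + _)%N](big_map (@tree_size d) xpredT id) -sumnE.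
suff H k ts : size ts = k ->
    homog (sumn [seq tree_size t | t <- ts] + tree_size u) (gograft_rec k ts u).
  by move=> h; exact: H h.
elim: k ts => [|k IH] [|t ts] //= => [_|[tsk]]; first exact: homogU.
apply: homogB.
  apply: homog_fglift => v; rewrite mem_dom => /(IH _ tsk) vE.
  by rewrite -addnA -vE; exact: homog_graft.
apply: homog_sum => j _; apply: homog_fglift => v; rewrite mem_dom => /homog_graft vE.
have := IH (set_nth t ts j v); rewrite size_set_nth (maxn_idPr (ltn_ord j)) => /(_ tsk).
suff -> : sumn [seq tree_size i | i <- set_nth t ts j v] =
          (tree_size t + sumn [seq tree_size i | i <- ts])%N by [].
move: vE; case: j => /= j; elim: ts j {IH tsk} => [//|a ts IH] [|j] /= jts vE.
  by rewrite vE addnA.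
by rewrite addnCA -(IH j).
Qed.

End TreeFacts.

Section Coefficients.
Variables (R : realType) (n d : nat).
Implicit Types (f : 'rV[R]_n -> 'rV[R]_n) (x : 'rV[R]_n) (I : seq 'I_n).

(* \partial_{i_1} ... \partial_{i_k} f for I = [:: i_1; ...; i_k] *)
Definition pderiv I f : 'rV[R]_n -> 'rV[R]_n :=
  foldr (fun i g x => 'D_('e_i) g x) f I.

Definition Ck (k : nat) f : Prop :=
  forall I, (size I <= k)%N -> continuous (pderiv I f) /\
    ((size I < k)%N -> forall i x, derivable (pderiv I f) x 'e_i).

(* The L^oo norm of the gradient of a Lipschitz function f, which is
   differentiable almost everywhere. *)
Definition grad_sup f : R :=
  sup [set `|'J f x| | x in [set x | differentiable f x]].

Variable sigma : 'I_d -> 'rV[R]_n -> 'rV[R]_n.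

Fixpoint pUpsilon (p : ptree d) x : 'rV[R]_n :=
  let: PNode j l := p in
  let Y := [seq pUpsilon q x | q <- l] in
  \sum_(I : (size l).-tuple 'I_n)
    (\prod_(r < size l) (Y`_r) 0 (tnth I r)) *: pderiv I (sigma j) x.

Definition Upsilon (t : tree d) : 'rV[R]_n -> 'rV[R]_n := pUpsilon (val t).

Definition Upsilon_lin (D : {freeg (tree d) / int}) x : 'rV[R]_n :=
  \sum_(t <- dom D) (coeff t D)%:~R *: Upsilon t x.

(* The product of the norms of the gradients of Upsilon_t over the trees with at
   most k vertices, WITHOUT the vanishing ones.  With a vanishing factor
   the full product is 0, and no bound by a multiple of it can hold:
   for n = 1, d = 2, sigma_1 (x) = x, sigma_2 (x) = 1, alpha = 1, t0 = \bullet_1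
   and X_t = (t, 0), Z_t = exp t, the case m = 0 reads
   Z_t - Z_s = H(1) (Z_t - Z_s), but the full product for k = 1 is 1 * 0. *)
Definition grad_prod (k : nat) : R :=
  \big[*%R/1]_(t \in [set t : tree d |
                       (tree_size t <= k)%N /\ grad_sup (Upsilon t) != 0])
     grad_sup (Upsilon t).

End Coefficients.

Section RoughPaths.
Variables (R : realType) (n d : nat).
Implicit Types (alpha T s t u : R) (N k : nat).
Implicit Types (X : R -> 'rV[R]_d) (Z : R -> 'rV[R]_n).
Implicit Types (XX : R -> R -> forest d -> R).

Definition holder alpha T X : Prop :=
  exists C : R, forall s t, 0 <= s -> s <= t -> t <= T ->
    `|X t - X s| <= C * `|t - s| `^ alpha.

(* XX s t is only relevant for 0 <= s <= t <= T and on forests with at most N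
   vertices. *)
Record branched_rough_path alpha N T XX : Prop := {
  brp_one : forall s t, 0 <= s -> s <= t -> t <= T -> XX s t mset0 = 1;
  brp_mul : forall s t, 0 <= s -> s <= t -> t <= T ->
    forall w : forest d, (forest_size w <= N)%N ->
      XX s t w = \prod_(r <- w) XX s t [mset r]%mset;
  brp_bound : exists C : R, forall s t, 0 <= s -> s <= t -> t <= T ->
    forall r : tree d, (tree_size r <= N)%N ->
      `|XX s t [mset r]%mset| <= C * `|t - s| `^ ((tree_size r)%:R * alpha);
  brp_chen : forall s u t, 0 <= s -> s <= u -> u <= t -> t <= T ->
    forall r : tree d, (tree_size r <= N)%N ->
      XX s t [mset r]%mset = XX s u [mset r]%mset +
        \sum_(p \in [set: forest d * tree d])
          XX s u p.1 / (forest_sym p.1)%:R * XX u t [mset p.2]%mset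
            * (coeff r (gograft p.1 p.2))%:~R }.

Definition is_lift T X XX : Prop :=
  forall s t, 0 <= s -> s <= t -> t <= T ->
    forall i : 'I_d, XX s t [mset bplus i mset0]%mset = X t 0 i - X s 0 i.

Variable sigma : 'I_d -> 'rV[R]_n -> 'rV[R]_n.

(* Z^{[k]}_{st}: the sum is over trees with at most k - 1 vertices *)
Definition sol_rem XX Z k s t : 'rV[R]_n :=
  Z t - Z s - \sum_(r \in [set r : tree d | (tree_size r < k)%N])
                XX s t [mset r]%mset *: Upsilon sigma r (Z s).

Definition davie_solution N T XX Z : Prop :=
  forall e : R, 0 < e -> exists2 delta : R, 0 < delta &
    forall s t, 0 <= s -> s <= t -> t <= T -> t - s < delta ->
      `|Z t - Z s - \sum_(r \in [set r : tree d | (tree_size r <= N)%N])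
           XX s t [mset r]%mset *: Upsilon sigma r (Z s)| <= e * (t - s).

(* B^{[k]}_{st}(r): the sum is over forests with at most k - 1 vertices *)
Definition B_rem XX Z (r : tree d) k s t : 'rV[R]_n :=
  Upsilon sigma r (Z t) -
  \sum_(w \in [set w : forest d | (forest_size w < k)%N])
    (XX s t w / (forest_sym w)%:R) *: Upsilon_lin sigma (gograft w r) (Z s).

End RoughPaths.

(* Main.v *)
(** Only uniform boundedness of H matters: the factors of the product are the
    nonzero ones, so the product is positive.  Fix x = Z_s, dl = Z_t - Z_s and
    U_tau = Upsilon_tau(x).  As X is multiplicative, comparing the coefficients of
    X(w) reduces the claim to finding bounded matrices H(w) with
      H(w) dl = \sum_(tau in w) H(w \ tau) U_tau - Upsilon_(w graft tau0)(x) / pi(w)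
    (plus the term Upsilon_tau0(x + dl) when w is empty); that is, the formal series
    Upsilon_tau0(x + dl) - Upsilon_tau0(x + V), V = \sum_tau X_tau U_tau, has to lie,
    up to a given order, in the module generated by dl - V with bounded matrix
    coefficients.  The obvious Taylor coefficients of Upsilon_tau0 are unbounded, so
    one argues by induction on the order for the interpolated series
      D(tau0)      = Upsilon_tau0(x + th dl) - Upsilon_tau0(x + th V),
      Q(tau, tau0) = (grad Upsilon_tau0(x + th dl) - grad Upsilon_tau0(x + th V)) U_tau.
    Integrating in th expresses D(tau0) through dl - V and the Q(tau, tau0), of
    strictly lower order; and writing U_tau as Upsilon_tau(x + th dl) minus an
    increment expresses Q(tau, tau0) through D(tau graft tau0), grad Upsilon_tau0 D(tau)
    and the Q(rho, tau0) with rho of strictly larger size, in which only the bounded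
    gradients of the Upsilons occur. *)
Require Import Defs.
From mathcomp Require Import all_boot all_order all_algebra finmap multiset.
From mathcomp Require Import all_classical all_reals all_analysis.
From mathcomp.multinomials Require Import freeg.
From mathcomp Require Import zify ring lra.
Import Order.TTheory GRing.Theory Num.Theory numFieldNormedType.Exports.

Set Implicit Arguments.
Unset Strict Implicit.
Unset Printing Implicit Defensive.

Local Open Scope mset_scope.
Local Open Scope classical_set_scope.
Local Open Scope ring_scope.

(** * Means of bounded functions on the unit interval *)

Section Mean.
Variable R : realType.
Implicit Types (f g h : R -> R) (C : R).

Definition bounded01 C g := forall t, 0 <= t <= 1 -> `|g t| <= C.

Definition riemann_avg g (k : nat) : R :=
  (\sum_(i < k.+1) g (i%:R / k.+1%:R)) / k.+1%:R.

Lemma riemann_avg_linear a g h k :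
  riemann_avg (fun t => a * g t + h t) k = a * riemann_avg g k + riemann_avg h k.
Proof. by rewrite /riemann_avg big_split /= -mulr_sumr mulrDl mulrA. Qed.

Lemma riemann_avg_bounded C g k : bounded01 C g -> `|riemann_avg g k| <= C.
Proof.
move=> gC; rewrite normrM normfV normr_nat ler_pdivrMr ?ltr0n//.
rewrite (le_trans (ler_norm_sum _ _ _))//.
apply: (@le_trans _ _ (\sum_(i < k.+1) C)).
  apply: ler_sum => i _; apply: gC; apply/andP; split; first by rewrite divr_ge0.
  by rewrite ler_pdivrMr ?ltr0n// mul1r ler_nat ltnW.
by rewrite sumr_const card_ord mulr_natr.
Qed.

(** Telescope [g 1 - g 0] over the grid. By the mean value theorem each increment is the grid step
    times [g'] at a point of the cell, and uniform continuity of [g'] compares this value with the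
    one at the grid point. *)
Lemma riemann_avg_derive g g' : (forall t : R, is_derive t (1 : R) g (g' t)) ->
  continuous g' -> riemann_avg g' k @[k --> \oo] --> g 1 - g 0.
Proof.
move=> dg cg'.
have cg : continuous g.
  by move=> t; apply/differentiable_continuous/derivable1_diffP/(@ex_derive _ _ _ _ _ _ _ (dg t)).
apply/cvgrPdist_le => e e0.
(* Uniform continuity from compactness, in near-covering form; [s] is not confined to the
   interval. *)
have unif : \forall r \near (0 : R), `[0, 1] `<=`
    [set t | forall s, `|t - s| <= `|r| -> `|g' t - g' s| <= e].
  have /compact_near_coveringP := @segment_compact R 0 1.
  move=> /(_ _ (nbhs (0 : R)) (fun r t => forall s, `|t - s| <= `|r| ->
    `|g' t - g' s| <= e)); apply => t _.
  have e2 : 0 < e / 2 by rewrite divr_gt0.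
  have /cvgrPdist_le /(_ _ e2)/nbhs_ballP[d /= d0 dP] := cg' t.
  have d2 : 0 < d / 2 by rewrite divr_gt0.
  exists (ball t (d / 2), ball (0 : R) (d / 2)).
    by split; exact: nbhsx_ballx.
  move=> [u r] /= [tu r0] s us; rewrite (splitr e).
  rewrite (le_trans (ler_distD (g' t) _ _))// lerD//.
    rewrite distrC; apply: dP; rewrite /ball/=; move: tu; rewrite /ball/=; lra.
  apply: dP; rewrite /ball/=; rewrite (le_lt_trans (ler_distD u _ _))//.
  move: tu r0; rewrite /ball/= sub0r normrN; lra.
have inv0 : (k.+1%:R : R)^-1 @[k --> \oo] --> 0 by exact: cvg_harmonic.
have {}unif : \forall k \near \oo, `[0, 1] `<=`
    [set t | forall s, `|t - s| <= `|k.+1%:R^-1| -> `|g' t - g' s| <= e].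
  exact: inv0 _ unif.
apply: filterS unif => k kP.
have K0 : 0 < (k.+1%:R : R) by rewrite ltr0n.
have -> : g 1 - g 0 = \sum_(i < k.+1) (g (i.+1%:R / k.+1%:R) - g (i%:R / k.+1%:R)).
  rewrite -(big_mkord xpredT (fun i => g (i.+1%:R / _) - g (i%:R / _))).
  rewrite (telescope_sumr (fun i => g (i%:R / k.+1%:R)))//.
  by rewrite mul0r divff// gt_eqF.
rewrite /riemann_avg mulr_suml -sumrB (le_trans (ler_norm_sum _ _ _))//.
apply: (@le_trans _ _ (\sum_(i < k.+1) e / k.+1%:R)); last first.
  by rewrite sumr_const card_ord -[_ / _ *+ _]mulr_natr divfK// gt_eqF.
apply: ler_sum => i _.
have ab : i%:R / k.+1%:R < i.+1%:R / k.+1%:R :> R.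
  by rewrite ltr_pM2r ?invr_gt0// ltr_nat.
have baE : i.+1%:R / k.+1%:R - i%:R / k.+1%:R = k.+1%:R^-1 :> R.
  by rewrite -mulrBl -natrB// subSnn mul1r.
have [|c + ->] := @MVT _ g g' _ _ ab (fun x _ => dg x).
  exact: continuous_subspaceT.
rewrite in_itv/= baE -mulrBl normrM normfV normr_nat => /andP[ac cb].
rewrite ler_pM2r ?invr_gt0// distrC; apply: kP.
  rewrite /= in_itv/=; apply/andP; split; first by rewrite divr_ge0.
  by rewrite ler_pdivrMr// mul1r ler_nat ltnW.
rewrite [leRHS]gtr0_norm ?invr_gt0//.
move: ac cb baE; set a := i%:R / _; set b := i.+1%:R / _ => ac cb baE.
by rewrite -baE ltr0_norm; lra.
Qed.

Lemma ultra_fmap (T T' : Type) (f : T -> T') (F : set_system T) :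
  UltraFilter F -> UltraFilter (f @ F).
Proof.
move=> FU; split=> [|G GF sFG]; first exact: fmap_proper_filter.
rewrite predeqE => A; split=> [GA|/sFG//].
have [//|FcA] := in_ultra_setVsetC (f @^-1` A) FU.
by case: (@filter_not_empty _ _ GF); rewrite -(setICr A); apply: filterI => //; exact: sFG.
Qed.

(* A substitute for the integral over [0, 1] that is defined on all bounded
   functions, so that no measurability has to be tracked. *)
Definition is_mean (L : (R -> R) -> R) : Prop :=
  [/\ forall a C D g h, bounded01 C g -> bounded01 D h ->
        L (fun t => a * g t + h t) = a * L g + L h,
      forall C g, bounded01 C g -> `|L g| <= C &
      forall g g', (forall t : R, is_derive t (1 : R) g (g' t)) -> continuous g' ->
        L g' = g 1 - g 0].

(** Take the limit of the Riemann averages along an ultrafilter refining [\oo]. It exists for every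
    bounded function by compactness of [[-C, C]], is linear and bounded as a limit, and agrees with
    the ordinary limit in [riemann_avg_derive]. *)
Theorem exists_mean : exists L, is_mean L.
Proof.
have [U [UU ooU]] := @ultraFilterLemma nat \oo _.
pose L g := lim (riemann_avg g k @[k --> U]).
have LP C g : bounded01 C g ->
    riemann_avg g k @[k --> U] --> L g /\ `|L g| <= C.
  move=> gC; have : compact (`[- C, C] : set R) by exact: segment_compact.
  rewrite compact_ultra => /(_ (riemann_avg g k @[k --> U])) [||l []].
  - exact: ultra_fmap.
  - apply: (@filterE _ U) => k; rewrite /= in_itv/= -ler_norml.
    exact: riemann_avg_bounded.
  rewrite /= in_itv/= -ler_norml => lC gl.
  by rewrite /L (cvg_lim _ gl).
exists L; split=> [a C D g h gC hD|C g /LP[]//|g g' dg cg'].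
  have [[gL _] [hL _]] := (LP _ _ gC, LP _ _ hD).
  apply: cvg_lim => //; under eq_fun do rewrite riemann_avg_linear.
  by apply: cvgD => //; exact: cvgMr.
apply: cvg_lim => //; have := riemann_avg_derive dg cg'.
by apply: cvg_trans; exact: cvg_app.
Qed.

Lemma bounded01_linear a C D g h : bounded01 C g -> bounded01 D h ->
  bounded01 (`|a| * C + D) (fun t => a * g t + h t).
Proof.
move=> gC hD t t01; rewrite (le_trans (ler_normD _ _))// lerD ?hD//.
by rewrite normrM ler_wpM2l// gC.
Qed.

(** The difference of the two functions has bound [0] on the unit interval, hence mean zero by
    linearity. *)
Lemma mean_ext L C g h : is_mean L -> bounded01 C g ->
  (forall t, 0 <= t <= 1 -> g t = h t) -> L g = L h.
Proof.
move=> [Llin Lbd _] gC gh.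
have hC : bounded01 C h by move=> t t01; rewrite -gh//; exact: gC.
have hgC : bounded01 0 (fun t => (-1) * h t + g t).
  by move=> t t01; rewrite gh// mulN1r addNr normr0.
apply/eqP; rewrite -subr_eq0 -normr_le0 -[L g - _]addrC -mulN1r.
by rewrite -(Llin _ _ _ _ _ hC gC); exact: Lbd.
Qed.

Lemma mean_sum L (J : Type) (s : seq J) (c : J -> R) (C : J -> R) (G : J -> R -> R) :
  is_mean L -> (forall a, bounded01 (C a) (G a)) ->
  L (fun t => \sum_(a <- s) c a * G a t) = \sum_(a <- s) c a * L (G a).
Proof.
move=> [Llin Lbd _] GC; elim: s => [|a s IH].
  rewrite big_nil; apply/eqP; rewrite -normr_le0; apply: Lbd => t _.
  by rewrite big_nil normr0.
under [X in L X]funext do rewrite big_cons.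
rewrite big_cons -IH; apply: Llin; first exact: GC.
instantiate (1 := \sum_(b <- s) `|c b| * C b) => t t01.
rewrite (le_trans (ler_norm_sum _ _ _))//; apply: ler_sum => b _.
by rewrite normrM ler_wpM2l//; exact: GC.
Qed.

Lemma mean_monomial L (a : R) k : is_mean L -> L (fun t => k.+1%:R * a * t ^+ k) = a.
Proof.
move=> [_ _ Lder]; pose p : {poly R} := a *: 'X^(k.+1).
have dp : horner p^`() = fun t => k.+1%:R * a * t ^+ k.
  by apply/funext => t; rewrite /p derivZ derivXn !hornerE hornerMn hornerXn; ring.
have der (t : R) : is_derive t (1 : R) (horner p) p^`().[t].
  by split; [exact: derivable_horner|rewrite derivE derive1E].
rewrite -dp (Lder _ _ der); last exact: continuous_horner.
by rewrite /p !hornerZ !hornerXn expr1n expr0n mulr1 mulr0 subr0.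
Qed.

End Mean.

(** * Functions with continuous partial derivatives *)

Section Smooth.
Variables (R : realType) (n : nat).
Implicit Types (g h : 'rV[R]_n -> R) (x y v : 'rV[R]_n) (i j : 'I_n).

Definition partial i g x : R := 'D_('e_i) g x.

Fixpoint smooth (k : nat) g : Prop :=
  continuous g /\ if k is k'.+1 then
    forall i, (forall x, derivable g x 'e_i) /\ smooth k' (partial i g)
  else True.

Lemma smooth_continuous k g : smooth k g -> continuous g.
Proof. by case: k => [|k] []. Qed.

Lemma smoothS k g : smooth k.+1 g -> smooth k g.
Proof.
by elim: k g => [|k IH] g [cg dg]; split=> // i; have [? /IH] := dg i.
Qed.

Lemma smooth_le k k' g : (k <= k')%N -> smooth k' g -> smooth k g.
Proof.
move=> /subnK <-; elim: (k' - k)%N => [//|m IH].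
by rewrite addSn => /(@smoothS _ _)/IH.
Qed.

Lemma smooth_partial k i g : smooth k.+1 g -> smooth k (partial i g).
Proof. by case=> _ /(_ i)[]. Qed.

Lemma smooth_derivable k i g x : smooth k.+1 g -> derivable g x 'e_i.
Proof. by case=> _ /(_ i)[]. Qed.

Lemma smooth_cst k (a : R) : smooth k (fun=> a).
Proof.
elim: k a => [|k IH] a; split=> //; try exact: cst_continuous.
move=> i; split=> [x|]; first exact: derivable_cst.
rewrite (_ : partial i _ = fun=> 0)//; apply/funext => x.
exact: derive_cst.
Qed.

Lemma partialD i g h : smooth 1 g -> smooth 1 h ->
  partial i (fun x => g x + h x) = fun x => partial i g x + partial i h x.
Proof.
move=> sg sh; apply/funext => x.
by rewrite /partial deriveD//; exact: (@smooth_derivable 0).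
Qed.

Lemma partialM i g h : smooth 1 g -> smooth 1 h ->
  partial i (fun x => g x * h x) =
  fun x => partial i g x * h x + g x * partial i h x.
Proof.
move=> sg sh; apply/funext => x.
rewrite /partial deriveM; try exact: (@smooth_derivable 0).
by rewrite addrC; congr (_ + _); rewrite [LHS]mulrC.
Qed.

Lemma smoothD k g h : smooth k g -> smooth k h -> smooth k (fun x => g x + h x).
Proof.
elim: k g h => [|k IH] g h sg sh.
  by split=> // x; apply: continuousD; [exact: (smooth_continuous sg)|exact: (smooth_continuous sh)].
split=> [x|i].
  by apply: continuousD; [exact: (smooth_continuous sg)|exact: (smooth_continuous sh)].
split=> [x|]; first by apply: derivableD; exact: (@smooth_derivable k).
rewrite partialD; try exact: smooth_le _ sg; try exact: smooth_le _ sh.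
by apply: IH; exact: smooth_partial.
Qed.

Lemma smoothM k g h : smooth k g -> smooth k h -> smooth k (fun x => g x * h x).
Proof.
elim: k g h => [|k IH] g h sg sh.
  by split=> // x; apply: continuousM; [exact: (smooth_continuous sg)|exact: (smooth_continuous sh)].
split=> [x|i].
  by apply: continuousM; [exact: (smooth_continuous sg)|exact: (smooth_continuous sh)].
split=> [x|]; first by apply: derivableM; exact: (@smooth_derivable k).
rewrite partialM; try exact: smooth_le _ sg; try exact: smooth_le _ sh.
by apply: smoothD; apply: IH; try exact: smooth_partial; exact: smoothS.
Qed.

Lemma smooth_sum k (J : Type) (s : seq J) (G : J -> 'rV[R]_n -> R) :
  (forall a, smooth k (G a)) -> smooth k (fun x => \sum_(a <- s) G a x).
Proof.
move=> sG; elim: s => [|a s IH].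
  by under [X in smooth k X]funext do rewrite big_nil; exact: smooth_cst.
by under [X in smooth k X]funext do rewrite big_cons; exact: smoothD.
Qed.

Lemma partial_sum i (J : Type) (s : seq J) (G : J -> 'rV[R]_n -> R) :
  (forall a, smooth 1 (G a)) ->
  partial i (fun x => \sum_(a <- s) G a x) = fun x => \sum_(a <- s) partial i (G a) x.
Proof.
move=> sG; elim: s => [|a s IH].
  under [X in partial i X]funext do rewrite big_nil.
  by apply/funext => x; rewrite big_nil; exact: derive_cst.
under [X in partial i X]funext do rewrite big_cons.
by rewrite partialD// ?IH; [apply/funext => x; rewrite big_cons|exact: smooth_sum].
Qed.

Lemma is_derive_line g v x (t : R) : derivable g (x + t *: v) v ->
  is_derive t (1 : R) (fun t => g (x + t *: v)) ('D_v g (x + t *: v)).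
Proof.
move=> dg.
suff E : (fun u => u^-1 *: (((fun t => g (x + t *: v)) \o shift t) (u *: (1 : R))
      - g (x + t *: v))) =
    (fun u => u^-1 *: ((g \o shift (x + t *: v)) (u *: v) - g (x + t *: v))).
  by split; rewrite /derivable /derive E.
by apply/funext => u /=; rewrite [_%:A]mulr1 scalerDl addrCA.
Qed.

(** * Mean value theorem, Schwarz's theorem and the chain rule along a line *)

Lemma norm_basis_le i : `|'e_i : 'rV[R]_n| <= 1.
Proof.
rewrite /Num.Def.normr/= mx_normrE; apply: bigmax_le => // -[a j] _.
by rewrite !mxE; case: (_ && _); rewrite ?normr1 ?normr0.
Qed.

Lemma MVT_partial g i x (a : R) : continuous g ->
  (forall y, derivable g y 'e_i) ->
  exists2 c, `|c| <= `|a| & g (x + a *: 'e_i) - g x = a * partial i g (x + c *: 'e_i).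
Proof.
move=> cg dg; pose G t := g (x + t *: 'e_i).
have dG t : is_derive t (1 : R) G (partial i g (x + t *: 'e_i)) by exact: is_derive_line.
have cG : continuous G.
  by move=> t; apply/differentiable_continuous/derivable1_diffP/(@ex_derive _ _ _ _ _ _ _ (dG t)).
have G0 : g x = G 0 by rewrite /G scale0r addr0.
have [a0|a0] := leP 0 a.
  have [|c] := @MVT_segment _ G _ _ _ a0 (fun t _ => dG t).
    exact: continuous_subspaceT.
  rewrite in_itv/= subr0 -G0 mulrC => /andP[c0 ca] ->; exists c => //.
  by rewrite !ger0_norm.
have [|c] := @MVT_segment _ G _ _ _ (ltW a0) (fun t _ => dG t).
  exact: continuous_subspaceT.
rewrite in_itv/= sub0r -G0 => /andP[c0 ca] e; exists c.
  by rewrite !ler0_norm ?lerN2// ltW.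
by apply: oppr_inj; rewrite opprB e mulrN mulrC.
Qed.

Lemma norm_shift_basis_le i (a : R) : `|a *: ('e_i : 'rV[R]_n)| <= `|a|.
Proof. by rewrite normrZ ler_piMr// norm_basis_le. Qed.

(** Apply the mean value theorem to [G] in direction [j], then to [partial j g] in direction [i]. *)
Lemma second_difference g i j x (r : R) : smooth 2 g ->
  exists2 z, `|z - x| <= `|r| + `|r| &
    (g (x + r *: 'e_j + r *: 'e_i) - g (x + r *: 'e_j)) - (g (x + r *: 'e_i) - g x) =
    r * (r * partial i (partial j g) z).
Proof.
move=> sg; pose G y := g (y + r *: 'e_i) - g y.
have cg := smooth_continuous sg; have dg y : derivable g y 'e_j := smooth_derivable sg.
have sjg := smooth_partial j sg; have cjg := smooth_continuous sjg.
have djg y : derivable (partial j g) y 'e_i := smooth_derivable sjg.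
clear sg sjg.
have shiftD y : is_derive y 'e_j (fun y => g (y + r *: 'e_i)) (partial j g (y + r *: 'e_i)).
  have E : (fun u => u^-1 *: (((fun y => g (y + r *: 'e_i)) \o shift y) (u *: 'e_j)
      - g (y + r *: 'e_i))) =
    (fun u => u^-1 *: ((g \o shift (y + r *: 'e_i)) (u *: 'e_j) - g (y + r *: 'e_i))).
    by apply/funext => u /=; rewrite addrA.
  by split; rewrite /derivable /partial /derive E//; exact: dg.
have [||c cr ->] := @MVT_partial G j x r.
- move=> y; apply: continuousB; last exact: cg.
  apply: continuous_comp; last exact: cg.
  by apply: continuousD; [exact: cvg_id|exact: cst_continuous].
- by move=> y; apply: derivableB; [exact: ex_derive|exact: dg].
have -> : partial j G (x + c *: 'e_j) =
    partial j g (x + c *: 'e_j + r *: 'e_i) - partial j g (x + c *: 'e_j).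
  apply: etrans (deriveB (@ex_derive _ _ _ _ _ _ _ (shiftD _)) (dg _)) _.
  by rewrite (@derive_val _ _ _ _ _ _ _ (shiftD _)).
have [c' c'r ->] := @MVT_partial (partial j g) i (x + c *: 'e_j) r cjg djg.
exists (x + c *: 'e_j + c' *: 'e_i) => //.
rewrite addrC -addrA addKr (le_trans (ler_normD _ _))// lerD//.
  exact: le_trans (norm_shift_basis_le _ _) cr.
exact: le_trans (norm_shift_basis_le _ _) c'r.
Qed.

(** The second difference is symmetric in [i] and [j], so the two mixed derivatives take a common
    value at points [z] and [z'] near [x]; continuity brings both points back to [x]. *)
Theorem schwarz g i j : smooth 2 g -> partial i (partial j g) = partial j (partial i g).
Proof.
move=> sg; apply/funext => x; apply/eqP; rewrite -subr_eq0 -normr_le0.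
apply/ler_addgt0Pl => e e0; rewrite addr0.
have e2 : 0 < e / 2 by rewrite divr_gt0.
have cij := smooth_continuous (smooth_partial i (smooth_partial j sg)).
have cji := smooth_continuous (smooth_partial j (smooth_partial i sg)).
have /cvgrPdist_le/(_ _ e2)/nbhs_ballP[d1 /= d10 d1P] := cij x.
have /cvgrPdist_le/(_ _ e2)/nbhs_ballP[d2 /= d20 d2P] := cji x.
(* The factor 3 leaves room for the displacement [r + r] allowed by [second_difference]. *)
pose r := Num.min d1 d2 / 3.
have r0 : 0 < r by rewrite divr_gt0// lt_min d10.
have [r1 r2] : r + r < d1 /\ r + r < d2.
  have m0 : 0 < Num.min d1 d2 by rewrite lt_min d10.
  have m1 : Num.min d1 d2 <= d1 by rewrite ge_min lexx.
  have m2 : Num.min d1 d2 <= d2 by rewrite ge_min lexx orbT.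
  by rewrite /r; split; lra.
have [z zx zE] := second_difference i j x r sg.
have [z' zx' zE'] := second_difference j i x r sg.
clear sg cij cji.
have zz' : partial i (partial j g) z = partial j (partial i g) z'.
  apply: (mulfI (lt0r_neq0 r0)); apply: (mulfI (lt0r_neq0 r0)).
  apply: etrans (esym zE) _; apply: etrans _ zE'.
  by rewrite [x + r *: 'e_i + _]addrAC; ring.
have ac : `|partial i (partial j g) x - partial i (partial j g) z| <= e / 2.
  apply: d1P; rewrite -ball_normE /ball_/= distrC.
  by apply: le_lt_trans zx _; rewrite gtr0_norm.
have bc : `|partial j (partial i g) x - partial j (partial i g) z'| <= e / 2.
  apply: d2P; rewrite -ball_normE /ball_/= distrC.
  by apply: le_lt_trans zx' _; rewrite gtr0_norm.
move: ac bc; rewrite zz'.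
move: (partial i _ x) (partial j _ x) (partial j _ z') => a b c ac bc.
rewrite (splitr e); apply: le_trans (ler_distD c a b) _.
by apply: lerD ac _; rewrite distrC.
Qed.

Lemma partial_coord_bound (v : 'rV[R]_n) k :
  `|\row_(j < n) (if (j < k)%N then v 0 j else 0)| <= `|v|.
Proof.
rewrite [leLHS]/Num.Def.normr/= mx_normrE; apply: bigmax_le => // -[a j] _.
rewrite !mxE/=; case: ifP => // _; rewrite ?normr0//.
rewrite /Num.Def.normr/= mx_normrE; exact: (le_bigmax _ _ (0, j)).
Qed.

(** Change the coordinates one at a time and apply the mean value theorem to each change; continuity
    of the partial derivatives moves the intermediate points to [y]. *)
Lemma is_derive_path g x v (t : R) : smooth 1 g ->
  is_derive t (1 : R) (fun t => g (x + t *: v))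
    (\sum_i v 0 i * partial i g (x + t *: v)).
Proof.
move=> sg; set y : 'rV[R]_n := x + t *: v; set S := \sum_i _.
suff : (fun u : R => u^-1 *: (g (y + u *: v) - g y)) @ 0^' --> S.
  move=> cS.
  have E : (fun u => u^-1 *: (((fun t => g (x + t *: v)) \o shift t) (u *: (1 : R))
      - g y)) = (fun u : R => u^-1 *: (g (y + u *: v) - g y)).
    by apply/funext => u /=; rewrite [_%:A]mulr1 scalerDl addrCA [u *: v + y]addrC.
  split; rewrite /derivable /derive -/y E; first by apply/cvg_ex; exists S.
  exact: cvg_lim cS.
apply/cvgrPdist_le => e e0.
pose B := \sum_i `|v 0 i|; have B0 : 0 <= B by apply: sumr_ge0.
(* Adding [1] keeps the denominator positive when [v] vanishes. *)
have e2 : 0 < e / (B + 1) by rewrite divr_gt0// ltr_wpDl.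
have near_y : \forall z \near y, forall i, `|partial i g y - partial i g z| <= e / (B + 1).
  apply: (@filter_forall _ 'I_n
    (fun i z => `|partial i g y - partial i g z| <= e / (B + 1)) (nbhs y)) => i.
  have cp := smooth_continuous (smooth_partial i sg).
  by have /cvgrPdist_le/(_ _ e2) := cp y.
have /nbhs_ballP[d /= d0 dP] := near_y.
near=> u.
have u0 : u != 0 by near: u; exact: nbhs_dnbhs_neq.
have ud : `|u| * (`|v| + `|v|) < d.
  have : `|u| < d / (`|v| + `|v| + 1).
    by near: u; apply: dnbhs0_lt; rewrite divr_gt0// ltr_wpDl// addr_ge0.
  rewrite ltr_pdivlMr ?ltr_wpDl ?addr_ge0//; have := normr_ge0 u; lra.
(* Truncation to the first [k] coordinates: consecutive points differ along a single basis
   vector. *)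
pose V (k : nat) := \row_(j < n) (if (j < k)%N then v 0 j else 0).
have VS (k : 'I_n) : V k.+1 = V k + v 0 k *: 'e_k.
  apply/rowP => j; rewrite !mxE/= ltnS leq_eqVlt -val_eqE/=.
  by case: eqP => [/val_inj ->|] /=; rewrite ?ltnn ?add0r ?mulr1 ?mulr0 ?addr0.
have -> : g (y + u *: v) - g y =
    \sum_(k < n) (g (y + u *: V k.+1) - g (y + u *: V k)).
  rewrite -(big_mkord xpredT (fun k => g (y + u *: V k.+1) - g (y + u *: V k))).
  rewrite (telescope_sumr (fun k => g (y + u *: V k)))//.
  congr (g (y + u *: _) - g _); first by apply/rowP => j; rewrite mxE ltn_ord.
  by apply/rowP => j; rewrite !mxE mulr0 addr0.
rewrite scaler_sumr -sumrB (le_trans (ler_norm_sum _ _ _))//.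
apply: (@le_trans _ _ (\sum_i `|v 0 i| * (e / (B + 1)))); last first.
  rewrite -mulr_suml mulrCA; apply: ler_piMr; first exact: ltW.
  by rewrite ler_pdivrMr ?ltr_wpDl// mul1r lerDl.
apply: ler_sum => k _; rewrite VS [u *: (_ + _)]scalerDr scalerA addrA.
have [c cu ->] := @MVT_partial g k (y + u *: V k) (u * v 0 k) (smooth_continuous sg)
  (fun y => smooth_derivable sg).
rewrite -mulrA [_ *: _]mulrA mulVf// mul1r -mulrBr normrM ler_wpM2l//.
apply: dP; rewrite -ball_normE /ball_/=.
have -> : y - (y + u *: V k + c *: 'e_k) = - (u *: V k + c *: 'e_k).
  by rewrite -(addrA y) opprD addrA subrr sub0r.
rewrite normrN.
apply: le_lt_trans ud; rewrite mulrDr (le_trans (ler_normD _ _))// lerD//.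
  by rewrite normrZ ler_wpM2l// partial_coord_bound.
rewrite (le_trans (norm_shift_basis_le _ _))// (le_trans cu)// normrM ler_wpM2l//.
rewrite [leRHS]/Num.Def.normr/= mx_normrE; exact: (le_bigmax _ _ (0, k)).
Unshelve. all: by end_near. Qed.

End Smooth.

(** * Iterated directional derivatives *)

Section Splits.
Variable A : Type.

(** The unshuffle coproduct, which indexes the Leibniz rule: every entry goes to one of two
    sublists. *)
Fixpoint splits (l : seq A) : seq (seq A * seq A) :=
  if l is a :: l' then
    [seq (a :: s.1, s.2) | s <- splits l'] ++ [seq (s.1, a :: s.2) | s <- splits l']
  else [:: ([::], [::])].

End Splits.

Section DirectionalDerivatives.
Variables (R : realType) (n : nat).
Implicit Types (g h : 'rV[R]_n -> R) (x y v w : 'rV[R]_n) (i j : 'I_n).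
Implicit Types (vs ws : seq 'rV[R]_n) (F : 'rV[R]_n -> 'rV[R]_n).

(* In coordinates, \nabla^k g . [v_1 ... v_k] for vs = [:: v_1; ...; v_k]. *)
Fixpoint dirD vs g x : R :=
  if vs is v :: vs' then \sum_i v 0 i * dirD vs' (partial i g) x else g x.

Definition vdirD vs F x : 'rV[R]_n := \row_j dirD vs (fun y => F y 0 j) x.

Definition vsmooth k F := forall j, smooth k (fun y => F y 0 j).

Lemma dirD_linear vs g h x (a : R) : smooth (size vs) g -> smooth (size vs) h ->
  dirD vs (fun y => a * g y + h y) x = a * dirD vs g x + dirD vs h x.
Proof.
elim: vs g h => [//|v vs IH] g h sg sh /=.
rewrite mulr_sumr -big_split; apply: eq_bigr => i _ /=.
have sag : smooth (size vs).+1 (fun y => a * g y) by apply: smoothM => //; exact: smooth_cst.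
rewrite partialD; try exact: smooth_le _ sag; try exact: smooth_le _ sh.
have -> : partial i (fun y => a * g y) = fun y => a * partial i g y.
  rewrite partialM; try exact: smooth_cst; try exact: smooth_le _ sg.
  apply/funext => y; rewrite [X in X * _](_ : _ = 0) ?mul0r ?add0r//.
  exact: derive_cst.
rewrite (IH (partial i g) (partial i h)); try exact: smooth_partial.
by rewrite mulrDr mulrCA.
Qed.

Lemma dirD0 vs x : dirD vs (fun=> 0) x = 0.
Proof.
elim: vs => [//|v vs IH] /=; rewrite big1// => i _.
rewrite (_ : partial i _ = fun=> 0) ?IH ?mulr0//; apply/funext => y.
exact: derive_cst.
Qed.

Lemma dirD_sum vs (J : Type) (s : seq J) (c : J -> R) (G : J -> 'rV[R]_n -> R) x :
  (forall a, smooth (size vs) (G a)) ->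
  dirD vs (fun y => \sum_(a <- s) c a * G a y) x = \sum_(a <- s) c a * dirD vs (G a) x.
Proof.
move=> sG; elim: s => [|a s IH].
  by under [X in dirD vs X]funext do rewrite big_nil; rewrite dirD0 big_nil.
under [X in dirD vs X]funext do rewrite big_cons.
rewrite dirD_linear ?big_cons ?IH//; apply: smooth_sum => b.
by apply: smoothM => //; exact: smooth_cst.
Qed.

Lemma dirD_swap v w vs g x : smooth (size vs).+2 g ->
  dirD (v :: w :: vs) g x = dirD (w :: v :: vs) g x.
Proof.
move=> sg /=; under eq_bigr do rewrite mulr_sumr.
rewrite exchange_big/=; apply: eq_bigr => i _; rewrite mulr_sumr.
apply: eq_bigr => j _; rewrite mulrCA schwarz//; exact: smooth_le _ sg.
Qed.

Lemma dirD_move v vs ws g x : smooth (size vs + size ws).+1 g ->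
  dirD (vs ++ v :: ws) g x = dirD (v :: vs ++ ws) g x.
Proof.
elim: vs g => [//|u vs IH] g sg; rewrite -dirD_swap; last by rewrite size_cat.
by apply: eq_bigr => i _; congr (_ * _); apply: IH; exact: smooth_partial.
Qed.

(** Schwarz's theorem, iterated in [dirD_move], brings the entry of [ws] matching the head of [vs]
    to the front. *)
Lemma dirD_perm vs ws g x : smooth (size vs) g -> perm_eq vs ws ->
  dirD vs g x = dirD ws g x.
Proof.
elim: vs ws g => [|v vs IH] ws g sg pvw.
  by move: pvw; rewrite perm_sym => /perm_nilP ->.
have vws : v \in ws by rewrite -(perm_mem pvw) mem_head.
case/splitPr: ws / vws pvw => ws1 ws2 pvw.
have {}pvw : perm_eq vs (ws1 ++ ws2).
  by move: pvw; rewrite -[v :: ws2]cat1s perm_sym perm_catCA perm_sym perm_cons.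
rewrite dirD_move -?size_cat -?(perm_size pvw)//.
by apply: eq_bigr => i _; congr (_ * _); apply: IH => //; exact: smooth_partial.
Qed.

Lemma dirDM vs g h x : smooth (size vs) g -> smooth (size vs) h ->
  dirD vs (fun y => g y * h y) x = \sum_(s <- splits vs) dirD s.1 g x * dirD s.2 h x.
Proof.
elim: vs g h => [|v vs IH] g h sg sh; first by rewrite /= big_seq1.
rewrite [RHS]big_cat/= !big_map/= -big_split/=.
transitivity (\sum_i v 0 i * \sum_(s <- splits vs)
   (dirD s.1 (partial i g) x * dirD s.2 h x + dirD s.1 g x * dirD s.2 (partial i h) x)).
  apply: eq_bigr => i _; congr (_ * _).
  have [sg' sh'] := (smoothS sg, smoothS sh).
  have [spg sph] := (smooth_partial i sg, smooth_partial i sh).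
  rewrite partialM; try exact: smooth_le _ sg; try exact: smooth_le _ sh.
  rewrite big_split -!IH//= -[X in _ = X + _]mul1r -dirD_linear; try exact: smoothM.
  by congr (dirD vs _ x); apply/funext => y; rewrite mul1r.
under [LHS]eq_bigr do rewrite mulr_sumr; rewrite exchange_big/=.
apply: eq_bigr => s _; rewrite mulr_suml mulr_sumr -big_split/=.
by apply: eq_bigr => i _; ring.
Qed.

(** The derivatives falling on [F] turn it into a new direction, the others stay directions for [g];
    this is the analytic source of [jet_graft]. *)
Lemma dirD_grad vs F g x : vsmooth (size vs) F -> smooth (size vs).+1 g ->
  dirD vs (fun y => \sum_i F y 0 i * partial i g y) x =
  \sum_(s <- splits vs) dirD (vdirD s.1 F x :: s.2) g x.
Proof.
move=> sF sg.
under [X in dirD vs X]funext do under eq_bigr do rewrite -[_ * _]mul1r.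
rewrite dirD_sum => [|i]; last by apply: smoothM => //; exact: smooth_partial.
rewrite exchange_big/=; apply: eq_bigr => i _.
rewrite mul1r dirDM//; last exact: smooth_partial.
by apply: eq_bigr => s _; rewrite mxE.
Qed.

Lemma dirD_set_nth_sum vs (r : nat) (J : Type) (s : seq J) (c : J -> R)
    (W : J -> 'rV[R]_n) g x : (r < size vs)%N ->
  dirD (set_nth 0 vs r (\sum_(a <- s) c a *: W a)) g x =
  \sum_(a <- s) c a * dirD (set_nth 0 vs r (W a)) g x.
Proof.
elim: vs r g => [//|v vs IH] [|r] g /= rvs.
  under [RHS]eq_bigr do rewrite mulr_sumr.
  rewrite exchange_big/=; apply: eq_bigr => i _.
  rewrite summxE mulr_suml; apply: eq_bigr => a _; rewrite mxE; ring.
under [RHS]eq_bigr do rewrite mulr_sumr.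
rewrite exchange_big/=; apply: eq_bigr => i _.
rewrite IH// mulr_sumr; apply: eq_bigr => a _; ring.
Qed.

Lemma smooth_dirD k (Fs : seq ('rV[R]_n -> 'rV[R]_n)) g :
  (forall F, List.In F Fs -> vsmooth k F) -> smooth (k + size Fs) g ->
  smooth k (fun y => dirD [seq F y | F <- Fs] g y).
Proof.
elim: Fs g => [|F Fs IH] g sFs /=; first by rewrite addn0.
move=> sg; apply: smooth_sum => i; apply: smoothM; first by apply: sFs; left.
apply: IH => [G GFs|]; first by apply: sFs; right.
by apply: smooth_partial; rewrite -addnS.
Qed.

(** Product rule for directions that vary with the point: the derivative falls on [g] or on one
    argument, just as grafting attaches a tree at the root or inside one branch. *)
Lemma partial_dirD c (Fs : seq ('rV[R]_n -> 'rV[R]_n)) g x :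
  (forall F, List.In F Fs -> vsmooth 1 F) -> smooth (size Fs).+1 g ->
  partial c (fun y => dirD [seq F y | F <- Fs] g y) x =
  dirD [seq F x | F <- Fs] (partial c g) x +
  \sum_(r < size Fs) dirD (set_nth 0 [seq F x | F <- Fs] r
     (\row_j partial c (fun y => nth (fun=> 0) Fs r y 0 j) x)) g x.
Proof.
elim: Fs g => [|F Fs IH] g sFs sg /=; first by rewrite big_ord0 addr0.
have sF : vsmooth 1 F by apply: sFs; left.
have {}sFs G : List.In G Fs -> vsmooth 1 G by move=> GFs; apply: sFs; right.
have sd i : smooth 1 (fun y => dirD [seq G y | G <- Fs] (partial i g) y).
  by apply: smooth_dirD => //; apply: smooth_partial; rewrite add1n.
rewrite partial_sum => [|i]; last by apply: smoothM; [exact: sF|exact: sd].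
rewrite big_ord_recl/= exchange_big/= addrA -!big_split/=.
apply: eq_bigr => i _; rewrite partialM//.
rewrite IH//; last exact: smooth_partial.
rewrite mxE schwarz; last exact: smooth_le _ sg.
rewrite mulrDr -mulr_sumr; ring.
Qed.

Definition pderivs (I : seq 'I_n) g : 'rV[R]_n -> R := foldr (@partial R n) g I.

Lemma smooth_pderivs k I g : smooth (size I + k) g -> smooth k (pderivs I g).
Proof.
by elim: I k => [//|i I IH] k /= sg; apply: smooth_partial; apply: IH; rewrite addnS.
Qed.

Lemma pderivs_partial i I g : smooth (size I).+1 g ->
  partial i (pderivs I g) = pderivs I (partial i g).
Proof.
elim: I => [//|j I IH] /= sg; rewrite schwarz ?IH//; first exact: smoothS.
by apply: smooth_pderivs; rewrite addn2.
Qed.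

(** Flattens the nested sums of [dirD] into the sum over index tuples that defines [pUpsilon]. *)
Lemma dirD_tuple vs g x : smooth (size vs) g ->
  dirD vs g x = \sum_(I : (size vs).-tuple 'I_n)
    (\prod_(r < size vs) vs`_r 0 (tnth I r)) * pderivs I g x.
Proof.
elim: vs g => [|v vs IH] g sg /=.
  rewrite (big_pred1 [tuple]) => [|I]; last by rewrite [I]tuple0; exact/esym/eqP.
  by rewrite big_ord0 mul1r.
rewrite (reindex (fun a : 'I_n * (size vs).-tuple 'I_n => [tuple of a.1 :: a.2]))/=; last first.
  exists (fun I => (thead I, [tuple of behead I])) => [[i I] _|I _] /=.
    by congr pair; apply: val_inj.
  by rewrite -tuple_eta.
rewrite -(pair_bigA _ (fun i (I : (size vs).-tuple 'I_n) =>
  (\prod_(r < (size vs).+1) (v :: vs)`_r 0 (tnth [tuple of i :: I] r)) *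
  partial i (pderivs I g) x))/=.
apply: eq_bigr => i _; rewrite IH ?mulr_sumr; last exact: smooth_partial.
apply: eq_bigr => I _; rewrite big_ord_recl/= -mulrA tnth0.
congr (_ * (_ * _)); first by apply: eq_bigr => r _; rewrite tnthS.
by rewrite pderivs_partial// size_tuple.
Qed.

End DirectionalDerivatives.

(** * Elementary differentials and grafting *)

Section ElementaryDifferentials.
Variables (R : realType) (n d N : nat) (sigma : 'I_d -> 'rV[R]_n -> 'rV[R]_n).
Hypothesis sigmaC : forall i, Ck N.-1 (sigma i).
Implicit Types (x y v : 'rV[R]_n) (f F : 'rV[R]_n -> 'rV[R]_n) (i j : 'I_n).

(** * Regularity of the elementary differentials *)

Lemma Ck_pderivs k f (I : seq 'I_n) j : Ck k f -> (size I <= k)%N ->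
  pderivs I (fun y => f y 0 j) = fun x => pderiv I f x 0 j.
Proof.
move=> Cf; elim: I => [//|i I IH] /= Ik; rewrite IH; last exact: ltnW.
apply/funext => x; rewrite derive_mx ?mxE//.
by have [_] := Cf I (ltnW Ik); exact.
Qed.

Lemma Ck_vsmooth k f : Ck k f -> vsmooth k f.
Proof.
(* For the induction, generalize to the derivative along [I] with [m] orders left. *)
move=> Cf j; suff H m (I : seq 'I_n) : (size I + m <= k)%N ->
    smooth m (pderivs I (fun y => f y 0 j)) by exact: (H k [::]).
elim: m I => [|m IH] I Im.
  rewrite (Ck_pderivs _ Cf); last by rewrite -[size I]addn0.
  split=> // x; have [cI _] := Cf I (leq_trans (leq_addr _ _) Im).
  apply: (@continuous_comp _ _ _ (pderiv I f) (fun M : 'rV[R]_n => M 0 j)).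
    exact: cI.
  exact: coord_continuous.
have Ik : (size I < k)%N by rewrite (leq_trans _ Im)// addnS ltnS leq_addr.
split=> [x|i].
  rewrite (Ck_pderivs _ Cf); last exact: ltnW.
  have [cI _] := Cf I (ltnW Ik).
  apply: (@continuous_comp _ _ _ (pderiv I f) (fun M : 'rV[R]_n => M 0 j)).
    exact: cI.
  exact: coord_continuous.
split=> [x|]; last by apply: (IH (i :: I)); rewrite /= addSnnS.
rewrite (Ck_pderivs _ Cf); last exact: ltnW.
by have [_ /(_ Ik i x)/derivable_mxP] := Cf I (ltnW Ik).
Qed.

Lemma sumn_ptree_size (l : seq (ptree d)) : (size l <= sumn [seq ptree_size u | u <- l])%N.
Proof. by elim: l => [//|-[a s] l IH] /=; rewrite addSn ltnS (leq_trans IH)// leq_addl. Qed.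

Lemma ptree_size_mem (q : ptree d) l : q \in l ->
  (ptree_size q <= sumn [seq ptree_size u | u <- l])%N.
Proof.
elim: l => [//|a l IH]; rewrite in_cons => /predU1P[->|/IH] /=; first exact: leq_addr.
by move=> /leq_trans; apply; exact: leq_addl.
Qed.

Lemma pUpsilonE a (l : seq (ptree d)) x j : (size l < N)%N ->
  pUpsilon sigma (PNode a l) x 0 j =
  dirD [seq pUpsilon sigma q x | q <- l] (fun y => sigma a y 0 j) x.
Proof.
move=> lN; have lN' : (size l <= N.-1)%N by case: (N) lN.
set Y := [seq _ | q <- l]; have sY : size Y = size l by rewrite size_map.
have sg : smooth (size Y) (fun y => sigma a y 0 j).
  by rewrite sY; exact: smooth_le (Ck_vsmooth (sigmaC a) j).
rewrite dirD_tuple// sY /= -/Y summxE; apply: eq_bigr => I _.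
rewrite mxE (Ck_pderivs _ (sigmaC a))//; first by rewrite size_tuple.
Qed.

(** The root consumes one of the [N.-1] derivatives of [sigma] per branch, and there are fewer
    branches than vertices; the branches are smaller trees, hence smoother than required. *)
Lemma pUpsilon_smooth p : (ptree_size p <= N)%N ->
  vsmooth (N - ptree_size p) (pUpsilon sigma p).
Proof.
elim/ptree_indP: p => a l IH /= lN j.
have szl := sumn_ptree_size l.
under [X in smooth _ X]funext do rewrite (pUpsilonE _ _ _ (leq_ltn_trans szl lN)).
have E y : [seq pUpsilon sigma q y | q <- l] = [seq F y | F <- [seq pUpsilon sigma q | q <- l]].
  by rewrite -map_comp.
under [X in smooth _ X]funext do rewrite E.
apply: smooth_dirD => [F|].
  move=> /List.in_map_iff[q [<- ql]] c.
  have {}ql : q \in l.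
    by elim: l ql {IH lN szl E} => //= b l IH [->|/IH ql]; rewrite in_cons ?eqxx ?ql ?orbT.
  have qs := ptree_size_mem ql.
  apply: smooth_le (IH q ql _ c); last exact: leq_trans qs (ltnW lN).
  by apply: leq_sub2l; exact: leqW.
rewrite size_map; apply: smooth_le (Ck_vsmooth (sigmaC a) j); lia.
Qed.

(** Symmetry of iterated derivatives makes the order of the branches irrelevant. *)
Lemma pUpsilon_pcanon p : (ptree_size p <= N)%N ->
  pUpsilon sigma (pcanon p) = pUpsilon sigma p.
Proof.
elim/ptree_indP: p => a l IH /= lN; apply/funext => x; apply/rowP => j.
have szl := leq_ltn_trans (sumn_ptree_size l) lN.
rewrite !pUpsilonE ?size_sort ?size_map//.
have -> : [seq pUpsilon sigma q x | q <- l] =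
    [seq pUpsilon sigma q x | q <- [seq pcanon u | u <- l]].
  rewrite -map_comp; apply/eq_in_map => q ql /=.
  by rewrite IH// (leq_trans (ptree_size_mem ql))// ltnW.
apply: dirD_perm; last by apply: perm_map; rewrite perm_sort.
rewrite size_map size_sort size_map.
by apply: smooth_le (Ck_vsmooth (sigmaC a) j); case: (N) szl.
Qed.

Lemma Upsilon_to_tree p : (ptree_size p <= N)%N ->
  Upsilon sigma (to_tree p) = pUpsilon sigma p.
Proof. exact: pUpsilon_pcanon. Qed.

Lemma Upsilon_smooth (t : tree d) : (tree_size t <= N)%N ->
  vsmooth (N - tree_size t) (Upsilon sigma t).
Proof. exact: pUpsilon_smooth. Qed.

(** * Grafting as differentiation *)

Definition lie (v : 'rV[R]_n) (F : 'rV[R]_n -> 'rV[R]_n) x : 'rV[R]_n := vdirD [:: v] F x.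

Lemma lieE v F x : lie v F x =
  \sum_i v 0 i *: \row_j partial i (fun y => F y 0 j) x.
Proof.
apply/rowP => j; rewrite !mxE/= summxE; apply: eq_bigr => i _.
by rewrite !mxE.
Qed.

Lemma size_pgraft (p q q' : ptree d) : q' \in pgraft p q ->
  ptree_size q' = (ptree_size p + ptree_size q)%N.
Proof.
elim/ptree_indP: q q' => a l IH q'; rewrite /= in_cons => /predU1P[->|/mapP[l' + ->]] /=.
  by rewrite addnS.
rewrite addnS => l'P; congr _.+1; elim: l IH l' l'P => [//|v l IHl] IH l'.
rewrite mem_cat => /orP[] /mapP[v' v'P ->] /=.
  by rewrite (IH v (mem_head _ _) v' v'P) addnA.
rewrite (IHl _ _ v'P); first exact: addnCA.
by move=> u ul; apply: IH; rewrite in_cons ul orbT.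
Qed.

(* A named copy of the inner recursion of [pgraft]. *)
Fixpoint pgraft_branch (p : ptree d) (l : seq (ptree d)) : seq (seq (ptree d)) :=
  if l is v :: l' then
    [seq u :: l' | u <- pgraft p v] ++ [seq v :: l'' | l'' <- pgraft_branch p l']
  else [::].

Lemma pgraftE (p : ptree d) a l :
  pgraft p (PNode a l) = PNode a (p :: l) :: [seq PNode a l' | l' <- pgraft_branch p l].
Proof. by congr (_ :: map _ _); elim: l => //= v l ->. Qed.

Lemma size_pgraft_branch (p : ptree d) l l' : l' \in pgraft_branch p l -> size l' = size l.
Proof.
elim: l l' => [//|v l IH] l' /=; rewrite mem_cat => /orP[] /mapP[u uP ->] //=.
by rewrite (IH _ uP).
Qed.

Lemma pUpsilon_branch (p : ptree d) l g x :
  \sum_(l' <- pgraft_branch p l) dirD [seq pUpsilon sigma q x | q <- l'] g x =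
  \sum_(r < size l) dirD (set_nth 0 [seq pUpsilon sigma q x | q <- l] r
     (\sum_(q <- pgraft p (nth p l r)) pUpsilon sigma q x)) g x.
Proof.
elim: l g => [|v l IH] g; first by rewrite /= big_nil big_ord0.
rewrite [LHS]big_cat/= !big_map big_ord_recl/=; congr (_ + _).
  rewrite exchange_big/=; apply: eq_bigr => i _.
  by rewrite summxE mulr_suml.
rewrite [LHS]exchange_big [RHS]exchange_big/=; apply: eq_bigr => i _.
by rewrite -!mulr_sumr IH.
Qed.

(** In the product rule [partial_dirD], the derivative of [sigma a] is the new branch at the root,
    and the derivative of the r-th argument is, by induction, grafting into the r-th branch. *)
Lemma pUpsilon_graft (p q : ptree d) x : (ptree_size p + ptree_size q <= N)%N ->
  \sum_(r <- pgraft p q) pUpsilon sigma r x = lie (pUpsilon sigma p x) (pUpsilon sigma q) x.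
Proof.
elim/ptree_indP: q => a l IH; rewrite pgraftE [ptree_size (PNode a l)]/= => pqN.
set P := pUpsilon sigma p x.
have lN := sumn_ptree_size l.
have p0 : (0 < ptree_size p)%N by case: (p).
have slN : (size l < N)%N by lia.
apply/rowP => j; rewrite big_cons mxE pUpsilonE/=; last by rewrite /=; lia.
rewrite mxE; set g := fun y => sigma a y 0 j.
have sg : smooth (size l).+1 g by apply: smooth_le (Ck_vsmooth (sigmaC a) j); lia.
have E y : [seq pUpsilon sigma q y | q <- l] = [seq F y | F <- [seq pUpsilon sigma q | q <- l]].
  by rewrite -map_comp.
have dE i : partial i (fun y => pUpsilon sigma (PNode a l) y 0 j) x =
    dirD [seq pUpsilon sigma q x | q <- l] (partial i g) x +
    \sum_(r < size l) dirD (set_nth 0 [seq pUpsilon sigma q x | q <- l] r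
     (\row_c partial i (fun y => pUpsilon sigma (nth p l r) y 0 c) x)) g x.
  under [X in partial i X]funext do rewrite (pUpsilonE _ _ _ slN) E.
  rewrite partial_dirD ?size_map//.
    rewrite -E; congr (_ + _); apply: eq_bigr => r _.
    congr (dirD (set_nth _ _ _ _) _ _); apply/rowP => c; rewrite !mxE.
    by rewrite (nth_map p).
  move=> F /List.in_map_iff[q [<- ql]] c.
  have {}ql : q \in l.
    by elim: l ql {IH pqN lN slN sg E} => //= b l IH [->|/IH ql]; rewrite in_cons ?eqxx ?ql ?orbT.
  have qs := ptree_size_mem ql.
  by apply: smooth_le (pUpsilon_smooth _ c); lia.
under [RHS]eq_bigr => i _ do rewrite dE mulrDr.
rewrite big_split/=; congr (_ + _).
rewrite big_map summxE big_seq.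
under eq_bigr => l' l'P.
  rewrite pUpsilonE; last by rewrite (size_pgraft_branch l'P).
  over.
rewrite -big_seq pUpsilon_branch.
under [RHS]eq_bigr => i _ do rewrite mulr_sumr.
rewrite exchange_big/=; apply: eq_bigr => r _.
rewrite -dirD_set_nth_sum ?size_map//; congr (dirD (set_nth _ _ _ _) _ _).
have rl : nth p l r \in l by rewrite mem_nth.
have rs := ptree_size_mem rl.
by rewrite IH// ?lieE//; lia.
Qed.

Lemma Upsilon_graft_planar (t u : tree d) x : (tree_size t + tree_size u <= N)%N ->
  \sum_(p <- pgraft (val t) (val u)) Upsilon sigma (to_tree p) x =
  lie (Upsilon sigma t x) (Upsilon sigma u) x.
Proof.
move=> tuN; rewrite -pUpsilon_graft//; apply: eq_big_seq => p pP.
by rewrite Upsilon_to_tree// (size_pgraft pP).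
Qed.

(** * Linear combinations of trees and the Guin-Oudom product *)

Implicit Types D : {freeg (tree d) / int}.

Lemma Upsilon_linE (s : seq (tree d)) D x : uniq s -> {subset dom D <= s} ->
  Upsilon_lin sigma D x = \sum_(t <- s) (coeff t D)%:~R *: Upsilon sigma t x.
Proof.
move=> us Ds; rewrite [RHS](bigID (mem (dom D)))/= [X in _ + X]big1 ?addr0.
  rewrite -big_filter; apply: perm_big; apply: uniq_perm.
  - exact: uniq_dom.
  - exact: filter_uniq.
  - by move=> t; rewrite mem_filter; case: (boolP (t \in dom D)) => // /Ds ->.
by move=> t /coeff_outdom ->; rewrite scale0r.
Qed.

Lemma Upsilon_linB D D' x :
  Upsilon_lin sigma (D - D') x = Upsilon_lin sigma D x - Upsilon_lin sigma D' x.
Proof.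
pose s := undup (dom D ++ dom D').
rewrite !(@Upsilon_linE s) ?undup_uniq//.
- rewrite -sumrB; apply: eq_bigr => t _.
  by rewrite coeffB intrB scalerBl.
- by move=> t tD; rewrite mem_undup mem_cat tD orbT.
- by move=> t tD; rewrite mem_undup mem_cat tD.
- by move=> t /domB; rewrite mem_undup.
Qed.

Lemma Upsilon_lin0 x : Upsilon_lin sigma (0 : {freeg (tree d) / int}) x = 0.
Proof. by rewrite -(subrr (0 : {freeg (tree d) / int})) Upsilon_linB subrr. Qed.

Lemma Upsilon_linD D D' x :
  Upsilon_lin sigma (D + D') x = Upsilon_lin sigma D x + Upsilon_lin sigma D' x.
Proof.
have linN : Upsilon_lin sigma (- D') x = - Upsilon_lin sigma D' x.
  by rewrite -[- D']sub0r Upsilon_linB Upsilon_lin0 sub0r.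
by rewrite -{1}[D']opprK Upsilon_linB linN opprK.
Qed.

Lemma Upsilon_lin_sum (J : Type) (s : seq J) (D : J -> {freeg (tree d) / int}) x :
  Upsilon_lin sigma (\sum_(a <- s) D a) x = \sum_(a <- s) Upsilon_lin sigma (D a) x.
Proof. exact: (big_morph (Upsilon_lin sigma ^~ x) (fun D D' => Upsilon_linD D D' x) (Upsilon_lin0 x)). Qed.

Lemma Upsilon_linU (t : tree d) x : Upsilon_lin sigma << t >> x = Upsilon sigma t x.
Proof. by rewrite /Upsilon_lin domU1 big_seq1 coeffU eqxx mulr1 scale1r. Qed.

Lemma Upsilon_linZ (a : int) D x :
  Upsilon_lin sigma (a *: D) x = a%:~R *: Upsilon_lin sigma D x.
Proof.
rewrite (@Upsilon_linE (dom D)) ?uniq_dom//; last exact: domZ_subset.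
rewrite scaler_sumr; apply: eq_bigr => t _.
by rewrite coeffZ intrM scalerA.
Qed.

Lemma Upsilon_lin_fglift (f : tree d -> {freeg (tree d) / int}) D x :
  Upsilon_lin sigma (fglift f D) x =
  \sum_(t <- dom D) (coeff t D)%:~R *: Upsilon_lin sigma (f t) x.
Proof.
rewrite -[D in fglift f D]freeg_sumE fglift_sum Upsilon_lin_sum.
by apply: eq_bigr => t _; rewrite liftU Upsilon_linZ.
Qed.

Definition homogeneous k D := forall t, t \in dom D -> tree_size t = k.

Lemma homogeneousB k D D' : homogeneous k D -> homogeneous k D' -> homogeneous k (D - D').
Proof. by move=> hD hD' t /domB; rewrite mem_cat => /orP[/hD|/hD']. Qed.

Lemma homogeneous_sum k (J : eqType) (s : seq J) (D : J -> {freeg (tree d) / int}) :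
  {in s, forall a, homogeneous k (D a)} -> homogeneous k (\sum_(a <- s) D a).
Proof.
move=> hD; rewrite big_seq; apply: (big_ind (homogeneous k)) => // [|E E' hE hE'].
  by move=> t; rewrite dom0.
by move=> t /domD_subset; rewrite mem_cat => /orP[/hE|/hE'].
Qed.

Lemma homogeneous_fglift k (f : tree d -> {freeg (tree d) / int}) D :
  {in dom D, forall t, homogeneous k (f t)} -> homogeneous k (fglift f D).
Proof.
move=> hf; rewrite -[D in fglift f D]freeg_sumE fglift_sum.
apply: homogeneous_sum => t tD; rewrite liftU => u /domZ_subset; exact: hf.
Qed.

Lemma homogeneous_graft (t u : tree d) : homogeneous (tree_size t + tree_size u) (graft t u).
Proof.
apply: homogeneous_sum => p pP r; rewrite domU1 inE => /eqP ->.
by rewrite /tree_size [LHS]ptree_size_pcanon (size_pgraft pP).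
Qed.

Definition seq_size (ts : seq (tree d)) : nat := sumn [seq tree_size t | t <- ts].

Lemma seq_size_set_nth (t r : tree d) ts (i : nat) : (i < size ts)%N ->
  tree_size r = (tree_size t + tree_size (nth t ts i))%N ->
  seq_size (set_nth t ts i r) = (tree_size t + seq_size ts)%N.
Proof.
rewrite /seq_size; elim: ts i => [|a ts IH] [|i] //= its rE.
  by rewrite rE addnA.
by rewrite IH// addnCA.
Qed.

Lemma homogeneous_gograft k ts (u : tree d) : size ts = k ->
  homogeneous (seq_size ts + tree_size u) (gograft_rec k ts u).
Proof.
elim: k ts => [|k IH] [|t ts] //=.
  by move=> _ r; rewrite domU1 inE => /eqP ->.
move=> [tsk].
apply: homogeneousB; first apply: homogeneous_fglift => v vD.
  by rewrite /seq_size/= -addnA -/(seq_size ts) -(IH _ tsk _ vD); exact: homogeneous_graft.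
apply: homogeneous_sum => i _; apply: homogeneous_fglift => v /homogeneous_graft vE.
rewrite /seq_size/= -/(seq_size ts) -(seq_size_set_nth (ltn_ord i) vE).
by apply: IH; rewrite size_set_nth (maxn_idPr (ltn_ord i)).
Qed.

Lemma Upsilon_lin_graft (t u : tree d) x : (tree_size t + tree_size u <= N)%N ->
  Upsilon_lin sigma (graft t u) x = lie (Upsilon sigma t x) (Upsilon sigma u) x.
Proof.
move=> tuN; rewrite -Upsilon_graft_planar// Upsilon_lin_sum.
by apply: eq_bigr => p _; rewrite Upsilon_linU.
Qed.

Lemma dirD_Upsilon_lin vs D x j :
  (forall t, t \in dom D -> (tree_size t + size vs <= N)%N) ->
  dirD vs (fun y => Upsilon_lin sigma D y 0 j) x =
  \sum_(t <- dom D) (coeff t D)%:~R * dirD vs (fun y => Upsilon sigma t y 0 j) x.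
Proof.
move=> DN; case E : (dom D) => [|t0 s].
  rewrite big_nil -[RHS](dirD0 vs x); congr (dirD vs _ x); apply/funext => y.
  by rewrite /Upsilon_lin E big_nil mxE.
rewrite -E (big_nth t0) big_mkord -dirD_sum => [|i].
  congr (dirD vs _ x); apply/funext => y.
  by rewrite /Upsilon_lin (big_nth t0) big_mkord summxE; under eq_bigr do rewrite mxE.
have tN := DN _ (mem_nth t0 (ltn_ord i)).
have tN' := leq_trans (leq_addr _ _) tN.
by apply: smooth_le (Upsilon_smooth tN' j); rewrite leq_subRL.
Qed.

Lemma map_set_nth (A B : Type) (f : A -> B) (a0 : A) (b0 : B) (s : seq A) (i : nat) a :
  (i < size s)%N -> map f (set_nth a0 s i a) = set_nth b0 (map f s) i (f a).
Proof. by elim: s i => [//|b s IH] [|i] //= /IH ->. Qed.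

Lemma size_seq_size (ts : seq (tree d)) : (size ts <= seq_size ts)%N.
Proof.
elim: ts => [//|t ts IH]; rewrite /seq_size/= -/(seq_size ts).
by have := tree_size_gt0 t; lia.
Qed.

Lemma seq_size_nth t (ts : seq (tree d)) (i : nat) : (i < size ts)%N ->
  (tree_size (nth t ts i) <= seq_size ts)%N.
Proof.
rewrite /seq_size; elim: ts i => [//|a ts IH] [|i] /= its; first exact: leq_addr.
by rewrite (leq_trans (IH i its))// leq_addl.
Qed.

(** Differentiating the identity for [ts] along the differential of [t] gives the wanted higher
    derivative plus terms where one argument is differentiated. The latter are the grafts of [t]
    into [ts], exactly what the Guin-Oudom correction subtracts. *)
Theorem Upsilon_gograft_rec k ts (u : tree d) x :
  size ts = k -> (seq_size ts + tree_size u <= N)%N ->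
  Upsilon_lin sigma (gograft_rec k ts u) x =
  vdirD [seq Upsilon sigma t x | t <- ts] (Upsilon sigma u) x.
Proof.
elim: k ts x => [|k IH] [|t ts] x //=.
  move=> _ _; by rewrite Upsilon_linU; apply/rowP => j; rewrite mxE.
move=> [tsk] tsN.
have {}tsN : (tree_size t + (seq_size ts + tree_size u) <= N)%N by rewrite addnA.
have t0 := tree_size_gt0 t; have tss := size_seq_size ts.
have szN (i : nat) (r : tree d) : r \in dom (graft t (nth t ts i)) -> (i < size ts)%N ->
    size (set_nth t ts i r) = k /\ (seq_size (set_nth t ts i r) + tree_size u <= N)%N.
  move=> /homogeneous_graft rE its; rewrite size_set_nth (maxn_idPr its).
  by rewrite (seq_size_set_nth its rE) -addnA.
rewrite Upsilon_linB Upsilon_lin_sum Upsilon_lin_fglift.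
apply/rowP => j; rewrite mxE [RHS]mxE; set f := fun y => Upsilon sigma u y 0 j.
have sf : smooth (size ts).+1 f by apply: smooth_le (Upsilon_smooth _ j); lia.
have -> : (\sum_(v <- dom (gograft_rec k ts u)) (coeff v (gograft_rec k ts u))%:~R *:
     Upsilon_lin sigma (graft t v) x) 0 j =
   lie (Upsilon sigma t x) (Upsilon_lin sigma (gograft_rec k ts u)) x 0 j.
  rewrite [RHS]mxE dirD_Upsilon_lin => [|v /(homogeneous_gograft tsk) ->]; last by rewrite /=; lia.
  rewrite summxE; apply: eq_big_seq => v /(homogeneous_gograft tsk) vE.
  by rewrite mxE Upsilon_lin_graft ?vE// mxE.
(* The induction hypothesis enters as an identity of functions, since it is differentiated next. *)
have -> : Upsilon_lin sigma (gograft_rec k ts u) =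
    fun y => vdirD [seq Upsilon sigma t y | t <- ts] (Upsilon sigma u) y.
  by apply/funext => y; apply: IH => //; lia.
have E y : [seq Upsilon sigma t y | t <- ts] = [seq F y | F <- [seq Upsilon sigma t | t <- ts]].
  by rewrite -map_comp.
have dE i : partial i (fun y => vdirD [seq Upsilon sigma t y | t <- ts] (Upsilon sigma u) y 0 j) x =
    dirD [seq Upsilon sigma t x | t <- ts] (partial i f) x +
    \sum_(r < size ts) dirD (set_nth 0 [seq Upsilon sigma t x | t <- ts] r
     (\row_c partial i (fun y => Upsilon sigma (nth t ts r) y 0 c) x)) f x.
  under [X in partial i X]funext do rewrite mxE E.
  rewrite partial_dirD ?size_map//.
    rewrite -E; congr (_ + _); apply: eq_bigr => r _.
    congr (dirD (set_nth _ _ _ _) _ _); apply/rowP => c; rewrite !mxE.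
    by rewrite (nth_map t).
  move=> F /List.in_map_iff[q [<- qts]] c.
  have qs : (tree_size q <= seq_size ts)%N.
    rewrite /seq_size; elim: ts qts {tsk tsN tss szN sf E} => //= b l IHl [->|/IHl ql].
      exact: leq_addr.
    by rewrite (leq_trans ql)// leq_addl.
  by apply: smooth_le (Upsilon_smooth _ c); lia.
rewrite mxE/=.
under eq_bigr => i _ do rewrite dE mulrDr.
(* The term where [Upsilon sigma u] is differentiated is the goal; the rest has to cancel. *)
rewrite big_split/= mxE -addrA -[RHS]addr0; congr (_ + _).
apply/eqP; rewrite subr_eq0; apply/eqP.
under eq_bigr => i _ do rewrite mulr_sumr.
rewrite exchange_big/= summxE; apply: eq_bigr => r _.
rewrite -dirD_set_nth_sum ?size_map// -lieE -Upsilon_lin_graft; last first.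
  by have := seq_size_nth t (ltn_ord r); lia.
rewrite Upsilon_lin_fglift dirD_set_nth_sum ?size_map// summxE; apply: eq_big_seq => v vP.
have [vk vN] := szN _ _ vP (ltn_ord r).
by rewrite mxE IH// mxE (map_set_nth _ _ 0).
Qed.

End ElementaryDifferentials.

(** * Series in the module generated by V - dl *)

Section Removals.
Variable A : Type.

(** In exponential normalization, multiplication of a series by [\sum_t X_t U_t] sums over these
    pairs. *)
Fixpoint removals (l : seq A) : seq (A * seq A) :=
  if l is a :: l' then (a, l') :: [seq (s.1, a :: s.2) | s <- removals l'] else [::].

Lemma size_removals l : size (removals l) = size l.
Proof. by elim: l => //= a l IH; rewrite size_map IH. Qed.

Lemma size_splits l : size (@splits A l) = (2 ^ size l)%N.
Proof. by elim: l => //= a l IH; rewrite size_cat !size_map IH expnS mul2n addnn. Qed.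

Variable V : nmodType.

(** Both sides distribute the list over a left part, one marked entry and a right part. *)
Lemma sum_splits_removals (F : seq A -> A -> seq A -> V) l :
  \sum_(s <- splits l) \sum_(s' <- removals s.2) F s.1 s'.1 s'.2 =
  \sum_(s <- removals l) \sum_(s' <- splits s.2) F s'.1 s.1 s'.2.
Proof.
elim: l F => [|a l IH] F; first by rewrite /= big_seq1 !big_nil.
rewrite /= big_cat !big_cons !big_map/=.
under [X in _ + X = _]eq_bigr => s _ do rewrite big_cons big_map/=.
under [X in _ = _ + X]eq_bigr => s _ do rewrite big_cat !big_map/=.
rewrite !big_split/= addrCA; congr (_ + (_ + _)).
  exact: (IH (fun p c r => F (a :: p) c r)).
exact: (IH (fun p c r => F p c (a :: r))).
Qed.

Lemma sum_splits_single (F : A -> seq A -> V) l :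
  \sum_(s <- splits l) (if s.1 is [:: a] then F a s.2 else 0) =
  \sum_(s <- removals l) F s.1 s.2.
Proof.
have nilE (G : seq A -> V) m : \sum_(s <- splits m) (if s.1 is [::] then G s.2 else 0) = G m :> V.
  elim: m G => [|a m IH] G; first by rewrite big_seq1.
  rewrite /= big_cat !big_map/= big1 ?add0r//.
  exact: (IH (fun q => G (a :: q))).
elim: l F => [|a l IH] F; first by rewrite /= big_seq1 big_nil.
rewrite /= big_cat big_cons !big_map/=; congr (_ + _).
  by rewrite -[RHS](nilE (F a)); apply: eq_bigr => -[[|b p] q].
by rewrite -(IH (fun b q => F b (a :: q))); apply: eq_bigr => -[[|b [|c p]] q].
Qed.

End Removals.

Lemma perm_removals (A : eqType) (l : seq A) s : s \in removals l -> perm_eq (s.1 :: s.2) l.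
Proof.
elim: l s => [//|a l IH] s /=; rewrite in_cons => /predU1P[->//|/mapP[r /IH rl ->]] /=.
by rewrite -[r.1 :: _]/([:: r.1] ++ [:: a] ++ r.2) perm_catCA /= perm_cons.
Qed.

Lemma splits_map (A B : Type) (f : A -> B) (l : seq A) :
  splits (map f l) = [seq (map f s.1, map f s.2) | s <- splits l].
Proof. by elim: l => //= a l ->; rewrite map_cat -!map_comp. Qed.

Lemma perm_splits (A : eqType) (l : seq A) s : s \in splits l -> perm_eq (s.1 ++ s.2) l.
Proof.
elim: l s => [|a l IH] s /=; first by rewrite inE => /eqP ->.
rewrite mem_cat => /orP[] /mapP[r /IH rl ->] /=; first by rewrite perm_cons.
by rewrite -cat1s perm_catCA /= perm_cons.
Qed.

Lemma seq_size_cat (d : nat) (l l' : seq (tree d)) :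
  seq_size (l ++ l') = (seq_size l + seq_size l')%N.
Proof. by rewrite /seq_size map_cat sumn_cat. Qed.

Lemma seq_size_perm (d : nat) (l l' : seq (tree d)) :
  perm_eq l l' -> seq_size l = seq_size l'.
Proof. by move=> pl; rewrite /seq_size !sumnE !big_map; exact: perm_big. Qed.

Lemma seq_size_splits (d : nat) (l : seq (tree d)) s : s \in splits l ->
  (seq_size s.1 + seq_size s.2)%N = seq_size l.
Proof. by move=> /perm_splits/seq_size_perm <-; rewrite seq_size_cat. Qed.

Lemma seq_size_removals (d : nat) (l : seq (tree d)) s : s \in removals l ->
  (tree_size s.1 + seq_size s.2)%N = seq_size l.
Proof. by move=> /perm_removals/seq_size_perm <-. Qed.

(** * Maximum norm estimates for matrices *)

Lemma norm_coord_le (R : realType) (m n : nat) (A : 'M[R]_(m, n)) i j : `|A i j| <= `|A|.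
Proof. by rewrite [leRHS]/Num.Def.normr/= mx_normrE; exact: (le_bigmax _ _ (i, j)). Qed.

Lemma norm_mx_le (R : realType) (m n : nat) (A : 'M[R]_(m, n)) (C : R) :
  0 <= C -> (forall i j, `|A i j| <= C) -> `|A| <= C.
Proof.
move=> C0 AC; rewrite [leLHS]/Num.Def.normr/= mx_normrE.
by apply: bigmax_le => // -[i j] _; exact: AC.
Qed.

Lemma norm_mulmx_le (R : realType) (m n p : nat) (A : 'M[R]_(m, n)) (B : 'M[R]_(n, p)) :
  `|A *m B| <= n%:R * (`|A| * `|B|).
Proof.
apply: norm_mx_le => [|i j]; first by rewrite !mulr_ge0.
rewrite mxE (le_trans (ler_norm_sum _ _ _))//.
apply: (@le_trans _ _ (\sum_(k < n) `|A| * `|B|)); last first.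
  by rewrite sumr_const card_ord mulr_natl.
by apply: ler_sum => k _; rewrite normrM ler_pM// norm_coord_le.
Qed.

Section Expandable.
Variables (R : realType) (n d : nat) (U : tree d -> 'rV[R]_n) (dl : 'rV[R]_n).
Implicit Types (C : R) (M : nat) (b : seq (tree d) -> 'rV[R]_n) (l : seq (tree d)).

(* [b] is the exponential generating series of a remainder, in commuting
   variables X_t.  That [b] is expandable means that, up to order [M], it lies in
   the module generated by [\sum_t X_t U_t - dl], with bounded coefficients [K]. *)
Definition expandable M C b : Prop :=
  exists K : seq (tree d) -> 'M[R]_n, forall l, (seq_size l <= M)%N ->
    `|K l| <= C /\ dl *m K l = \sum_(s <- removals l) U s.1 *m K s.2 - b l.

Lemma expandable_ext M C b b' : (forall l, (seq_size l <= M)%N -> b l = b' l) ->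
  expandable M C b -> expandable M C b'.
Proof. by move=> bb' [K KP]; exists K => l lM; rewrite -bb'//; exact: KP. Qed.

Lemma expandable_le M C C' b : C <= C' -> expandable M C b -> expandable M C' b.
Proof.
by move=> CC' [K KP]; exists K => l /KP[KC Ke]; split => //; exact: le_trans CC'.
Qed.

Lemma expandableD M C C' b b' : expandable M C b -> expandable M C' b' ->
  expandable M (C + C') (fun l => b l + b' l).
Proof.
move=> [K KP] [K' KP']; exists (fun l => K l + K' l) => l lM.
have [[KC Ke] [KC' Ke']] := (KP l lM, KP' l lM); split.
  by rewrite (le_trans (ler_normD _ _))// lerD.
rewrite mulmxDr Ke Ke' addrACA -opprD; congr (_ - _); rewrite -big_split/=.
by apply: eq_bigr => s _; rewrite mulmxDr.
Qed.

Lemma expandable0 M : expandable M 0 (fun=> 0).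
Proof.
exists (fun=> 0) => l _; split; first by rewrite normr0.
by rewrite mulmx0 big1 ?subr0// => s _; rewrite mulmx0.
Qed.

Lemma expandable_sum M (J : eqType) (s : seq J) (C : J -> R)
    (b : J -> seq (tree d) -> 'rV[R]_n) :
  (forall a, a \in s -> expandable M (C a) (b a)) ->
  expandable M (\sum_(a <- s) C a) (fun l => \sum_(a <- s) b a l).
Proof.
elim: s => [_|a s IH bC].
  rewrite big_nil; apply: expandable_ext (expandable0 M) => l _.
  by rewrite big_nil.
have {}IH : expandable M (\sum_(a <- s) C a) (fun l => \sum_(a <- s) b a l).
  by apply: IH => c cs; apply: bC; rewrite in_cons cs orbT.
rewrite big_cons; apply: expandable_ext (expandableD (bC a (mem_head _ _)) IH) => l _.
by rewrite big_cons.
Qed.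

Lemma expandable_mulmx M C b (A : 'M[R]_n) : expandable M C b ->
  expandable M (n%:R * (C * `|A|)) (fun l => b l *m A).
Proof.
move=> [K KP]; exists (fun l => K l *m A) => l lM; have [KC Ke] := KP l lM; split.
  by rewrite (le_trans (norm_mulmx_le _ _))// ler_wpM2l// ler_wpM2r.
rewrite mulmxA Ke mulmxBl mulmx_suml; congr (_ - _).
by apply: eq_bigr => s _; rewrite mulmxA.
Qed.

Lemma expandableZ M C b (a : R) : expandable M C b ->
  expandable M (`|a| * C) (fun l => a *: b l).
Proof.
move=> [K KP]; exists (fun l => a *: K l) => l lM; have [KC Ke] := KP l lM; split.
  by rewrite normrZ ler_wpM2l.
rewrite -scalemxAr Ke scalerBr scaler_sumr; congr (_ - _).
by apply: eq_bigr => s _; rewrite scalemxAr.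
Qed.

Lemma expandableB M C C' b b' : expandable M C b -> expandable M C' b' ->
  expandable M (C + C') (fun l => b l - b' l).
Proof.
move=> bC /(expandableZ (-1)); rewrite normrN1 mul1r => /(expandableD bC).
by apply: expandable_ext => l _; rewrite scaleN1r.
Qed.

(** A power series whose coefficients [b p] lie in the module stays in it; the prefix [p] uses up
    [seq_size p] of the order. The quotients are summed over splits, at most [2 ^ M] in number. *)
Lemma expandable_split M C (b : seq (tree d) -> seq (tree d) -> 'rV[R]_n) : 0 <= C ->
  (forall p, (seq_size p <= M)%N -> expandable (M - seq_size p) C (b p)) ->
  expandable M (2 ^+ M * C) (fun l => \sum_(s <- splits l) b s.1 s.2).
Proof.
move=> C0 bC.
(* The quotients are chosen for all [p] at once, with default 0 beyond order [M]. *)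
have [K KP] : {K : seq (tree d) -> seq (tree d) -> 'M[R]_n & forall p,
    (seq_size p <= M)%N -> forall l, (seq_size l <= M - seq_size p)%N ->
    `|K p l| <= C /\ dl *m K p l = \sum_(s <- removals l) U s.1 *m K p s.2 - b p l}.
  apply: (@choice _ _ (fun p K => (seq_size p <= M)%N -> forall l,
    (seq_size l <= M - seq_size p)%N -> `|K l| <= C /\
    dl *m K l = \sum_(s <- removals l) U s.1 *m K s.2 - b p l)) => p.
  have [pM|_] := boolP (seq_size p <= M)%N; last by exists (fun=> 0).
  by have [K KP] := bC p pM; exists K.
have {}KP l s : (seq_size l <= M)%N -> s \in splits l -> `|K s.1 s.2| <= C /\
    dl *m K s.1 s.2 = \sum_(s' <- removals s.2) U s'.1 *m K s.1 s'.2 - b s.1 s.2.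
  move=> lM /seq_size_splits ss; have s1M : (seq_size s.1 <= M)%N.
    by rewrite (leq_trans _ lM)// -ss leq_addr.
  by apply: KP => //; rewrite leq_subRL// ss.
exists (fun l => \sum_(s <- splits l) K s.1 s.2) => l lM; split.
  rewrite (le_trans (ler_norm_sum _ _ _))// big_seq.
  apply: (@le_trans _ _ (\sum_(s <- splits l | s \in splits l) C)).
    by apply: ler_sum => s /(KP _ _ lM)[].
  rewrite -big_seq big_const_seq iter_addr addr0 count_predT size_splits -[C *+ _]mulr_natl.
  rewrite ler_wpM2r// natrX ler_weXn2l ?ler1n// (leq_trans _ lM)//.
  exact: size_seq_size.
rewrite mulmx_sumr.
under [in RHS]eq_bigr => s _ do rewrite mulmx_sumr.
rewrite -(sum_splits_removals (fun p a q => U a *m K p q)) -sumrB.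
by apply: eq_big_seq => s /(KP _ _ lM)[].
Qed.

Lemma expandable_removals M C (b : tree d -> seq (tree d) -> 'rV[R]_n) : 0 <= C ->
  (forall a, (tree_size a <= M)%N -> expandable (M - tree_size a) C (b a)) ->
  expandable M (2 ^+ M * C) (fun l => \sum_(s <- removals l) b s.1 s.2).
Proof.
move=> C0 bC.
apply: expandable_ext (@expandable_split M C
  (fun p => if p is [:: a] then b a else fun=> 0) C0 _) => [l _|p pM].
  by rewrite -sum_splits_single; apply: eq_bigr => -[[|a [|c p]] q].
have e0 m : expandable m C (fun=> 0) by exact: expandable_le (expandable0 m).
case: p pM => [|a [|c p]] //; rewrite /seq_size /= addn0 => aM.
exact: bC.
Qed.

(** The series is the generator times [A], so the quotient is the constant series [A]. *)
Lemma expandable_generator M (A : 'M[R]_n) :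
  expandable M `|A| (fun l => match l with
    [::] => - (dl *m A) | [:: a] => U a *m A | _ => 0 end).
Proof.
exists (fun l => if l is [::] then A else 0) => -[|a [|c l]] _ /=.
- by split=> //; rewrite big_nil sub0r opprK.
- by rewrite normr0 mulmx0 big_seq1 subrr.
- rewrite normr0 mulmx0 subr0; split=> //; rewrite !big_cons !big_map/= !mulmx0.
  by rewrite big1 ?addr0// => s _; rewrite mulmx0.
Qed.

Lemma norm_attained (v : 'rV[R]_n) : v != 0 -> exists i, `|v 0 i| = `|v|.
Proof.
move=> v0; apply: contrapT => /forallNP vi.
have : `|v| < `|v|.
  rewrite [ltLHS]/Num.Def.normr/= mx_normrE; apply: bigmax_lt => [|[a i] _].
    by rewrite normr_gt0.
  by rewrite /= ord1 lt_neqAle norm_coord_le andbT; exact/eqP/vi.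
by rewrite ltxx.
Qed.

(** Only the empty list has weight 0, so a single linear equation for one matrix has to be
    solved. *)
Lemma expandable_order0 C b : 0 <= C -> `|b [::]| <= C * `|dl| -> expandable 0 C b.
Proof.
move=> C0 bC.
suff [A AC dlA] : exists2 A : 'M[R]_n, `|A| <= C & dl *m A = - b [::].
  exists (fun=> A) => -[_|a l]; first by rewrite big_nil sub0r.
  by rewrite /seq_size/=; have := tree_size_gt0 a; lia.
have [dl0|dl0] := eqVneq dl 0.
  exists 0; rewrite ?normr0// mulmx0; move: bC.
  by rewrite dl0 normr0 mulr0 normr_le0 => /eqP ->; rewrite oppr0.
have [i iE] := norm_attained dl0.
have di0 : dl 0 i != 0 by rewrite -normr_eq0 iE normr_eq0.
(* Filling only the row of a coordinate that realizes the norm of [dl] keeps the entries below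
   [C]. *)
exists (\matrix_(a, c) (if a == i then - b [::] 0 c / dl 0 i else 0)).
  apply: norm_mx_le => // a c; rewrite mxE; case: ifP => _; last by rewrite normr0.
  rewrite normrM normfV normrN iE ler_pdivrMr ?normr_gt0//.
  exact: le_trans (norm_coord_le _ _ _) bC.
apply/rowP => c; rewrite !mxE (bigD1 i)//= mxE eqxx mulrCA divff// mulr1 big1 ?addr0//.
by move=> a ai; rewrite mxE (negbTE ai) mulr0.
Qed.

(** Average the quotients entrywise. They are picked by choice for each [t], with no regularity in
    [t], which is why the mean must be defined on all bounded functions. *)
Lemma expandable_mean L M C (b : R -> seq (tree d) -> 'rV[R]_n) : is_mean L ->
  (forall t, 0 <= t <= 1 -> expandable M C (b t)) ->
  expandable M C (fun l => \row_j L (fun t => b t l 0 j)).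
Proof.
move=> meanL bC; have [Llin Lbd _] := meanL.
have [K KP] : {K : R -> seq (tree d) -> 'M[R]_n & forall t, 0 <= t <= 1 ->
    forall l, (seq_size l <= M)%N ->
    `|K t l| <= C /\ dl *m K t l = \sum_(s <- removals l) U s.1 *m K t s.2 - b t l}.
  apply: (@choice _ _ (fun t K => 0 <= t <= 1 -> forall l,
    (seq_size l <= M)%N -> `|K l| <= C /\
    dl *m K l = \sum_(s <- removals l) U s.1 *m K s.2 - b t l)) => t.
  have [/bC[K KP]|_] := boolP (0 <= t <= 1); first by exists K.
  by exists (fun=> 0).
have C0 : 0 <= C.
  have [|KC _] := KP 0 _ [::] isT; first by rewrite lexx ler01.
  exact: le_trans KC.
(* Cut off beyond order [M], where nothing bounds [K]. *)
pose Km t l i j := if (seq_size l <= M)%N then K t l i j else 0.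
have Kbd l i j : bounded01 C (fun t => Km t l i j).
  move=> t t01; rewrite /Km; case: ifP => [lM|_]; last by rewrite normr0.
  by rewrite (le_trans (norm_coord_le _ _ _))//; have [] := KP t t01 l lM.
have vKbd (v : 'rV[R]_n) l j :
    bounded01 (\sum_i `|v 0 i| * C) (fun t => \sum_i v 0 i * Km t l i j).
  move=> t t01; rewrite (le_trans (ler_norm_sum _ _ _))//; apply: ler_sum => i _.
  by rewrite normrM ler_wpM2l// Kbd.
have vKE (v : 'rV[R]_n) t l j : (seq_size l <= M)%N ->
    (v *m K t l) 0 j = \sum_i v 0 i * Km t l i j.
  by move=> lM; rewrite mxE; apply: eq_bigr => i _; rewrite /Km lM.
exists (fun l => \matrix_(i, j) L (fun t => Km t l i j)) => l lM; split.
  by apply: norm_mx_le => [//|i j]; rewrite mxE; exact: Lbd.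
have LE (v : 'rV[R]_n) l' j : (v *m \matrix_(i, j) L (fun t => Km t l' i j)) 0 j =
    L (fun t => \sum_i v 0 i * Km t l' i j).
  rewrite mxE (mean_sum _ _ meanL (fun i => Kbd l' i j)).
  by apply: eq_bigr => i _; rewrite mxE.
apply/rowP => j; rewrite LE mxE summxE [X in _ + X]mxE mxE.
under eq_bigr do rewrite LE.
have sbd : bounded01 (\sum_(s <- removals l) \sum_i `|U s.1 0 i| * C)
    (fun t => \sum_(s <- removals l) 1 * \sum_i U s.1 0 i * Km t s.2 i j).
  move=> t t01; rewrite (le_trans (ler_norm_sum _ _ _))//; apply: ler_sum => s _.
  by rewrite mul1r; exact: vKbd.
(* Solved for [b], the equation of the quotients exhibits [b] as a combination of bounded
   functions. *)
have bE t : 0 <= t <= 1 -> (-1) * (\sum_i dl 0 i * Km t l i j) +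
    (\sum_(s <- removals l) 1 * \sum_i U s.1 0 i * Km t s.2 i j) = b t l 0 j.
  move=> t01; have SE : \sum_(s <- removals l) 1 * \sum_i U s.1 0 i * Km t s.2 i j =
      (\sum_(s <- removals l) U s.1 *m K t s.2) 0 j.
    rewrite summxE; apply: eq_big_seq => s sl.
    by rewrite mul1r vKE// (leq_trans _ lM)// -(seq_size_removals sl) leq_addl.
  have [_ /rowP/(_ j)] := KP t t01 l lM.
  rewrite vKE// mxE -SE [(- b t l) 0 j]mxE => ->; ring.
rewrite -(mean_ext meanL (bounded01_linear (-1) (vKbd dl l j) sbd) bE).
rewrite (Llin _ _ _ _ _ (vKbd dl l j) sbd) mulN1r opprD opprK.
rewrite (@mean_sum _ L _ (removals l) (fun=> 1) _
  (fun s t => \sum_i U s.1 0 i * Km t s.2 i j) meanL (fun s => vKbd (U s.1) s.2 j)).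
by under [X in _ - X]eq_bigr do rewrite mul1r; rewrite addrC subrK.
Qed.

End Expandable.

(** * The induction on the order *)

Lemma sum_splits_nil_l (A : Type) (V : nmodType) (F : seq A -> seq A -> V) l :
  \sum_(s <- splits l) F s.1 s.2 =
  F [::] l + \sum_(s <- splits l) (if s.1 is [::] then 0 else F s.1 s.2).
Proof.
elim: l F => [|a l IH] F; first by rewrite /= !big_seq1 addr0.
rewrite /= !big_cat !big_map/= (IH (fun p q => F p (a :: q))).
by rewrite addrCA.
Qed.

Lemma sum_splits_nil_r (A : Type) (V : nmodType) (F : seq A -> V) l :
  \sum_(s <- splits l) (if s.2 is [::] then F s.1 else 0) = F l.
Proof.
elim: l F => [|a l IH] F; first by rewrite /= !big_seq1.
rewrite /= !big_cat !big_map/= [X in _ + X]big1 ?addr0//.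
exact: (IH (fun p => F (a :: p))).
Qed.

Lemma seq_uniform_bound (R : realType) (T : eqType) (P : T -> R -> Prop) (s : seq T) :
  (forall a C D, C <= D -> P a C -> P a D) -> (forall a, a \in s -> exists C, P a C) ->
  exists2 C, 0 <= C & forall a, a \in s -> P a C.
Proof.
move=> Pmono; elim: s => [|a s IH] sP; first by exists 0.
have [b bs|C C0 CP] := IH; first by apply: sP; rewrite in_cons bs orbT.
have [D DP] := sP a (mem_head _ _).
exists (Num.max C D); first by rewrite le_max C0.
move=> b; rewrite in_cons => /predU1P[->|bs].
  by apply: Pmono DP; rewrite le_max lexx orbT.
by apply: Pmono (CP _ bs); rewrite le_max lexx.
Qed.

Lemma finite_uniform_bound (R : realType) (T : choiceType) (P : T -> R -> Prop) (A : set T) :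
  finite_set A ->
  (forall a C D, C <= D -> P a C -> P a D) -> (forall a, A a -> exists C, P a C) ->
  exists2 C, 0 <= C & forall a, A a -> P a C.
Proof.
move=> /finite_seqP[s ->] Pmono AP.
by have [a /AP|C C0 CP] := seq_uniform_bound Pmono (s := s); last by exists C.
Qed.

Lemma finite_tree_seqs (d M : nat) : finite_set [set l : seq (tree d) | (seq_size l <= M)%N].
Proof.
apply: sub_finite_set (finite_seqs M (finite_trees d M)) => l /= lM; split.
  exact: leq_trans (size_seq_size l) lM.
by move=> i x0 il; exact: leq_trans (seq_size_nth x0 il) lM.
Qed.

(** Every difference quotient obeys the bound, and one of them is within [e] of the derivative. *)
Lemma derive_lipschitz (R : realType) (V W : normedModType R) (f : V -> W) (L : R) x v :
  L.-lipschitz f -> derivable f x v -> `|'D_v f x| <= L * `|v|.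
Proof.
move=> fL dfx; apply/ler_addgt0Pl => e e0.
have /cvgrPdist_le/(_ _ e0) := dfx.
rewrite -/('D_v f x) near_withinE => /nbhs_ballP[r /= r0 rP].
have r2 : 0 < r / 2 by rewrite divr_gt0.
have := rP (r / 2); rewrite /ball/= sub0r normrN gtr0_norm// => /(_ _ (lt0r_neq0 r2)).
rewrite ltr_pdivrMr// ltr_pMr// ltr1n => /(_ isT) De.
rewrite -[leLHS](subrK (`|(r / 2)^-1 *: (f (r / 2 *: v + x) - f x)|)).
rewrite lerD//; first exact: le_trans (lerB_dist _ _) De.
rewrite normrZ normfV gtr0_norm// ler_pdivrMl//.
apply: le_trans (fL (r / 2 *: v + x, x) _) _ => //=.
by rewrite addrK normrZ gtr0_norm// mulrCA.
Qed.

Section MainEstimate.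
Variables (R : realType) (n d N : nat) (sigma : 'I_d -> 'rV[R]_n -> 'rV[R]_n).
Hypothesis sigmaC : forall i, Ck N.-1 (sigma i).
Hypothesis UpsilonL : forall r : tree d, (tree_size r <= N)%N ->
  exists L : R, L.-lipschitz (Upsilon sigma r).
Implicit Types (x y v dl : 'rV[R]_n) (t u : tree d) (l : seq (tree d)) (M : nat).

(** The coefficient of [l] in the Taylor series of [Upsilon sigma u] at the formal point
    [x + \sum_t X_t U_t]. *)
Definition jet l u x : 'rV[R]_n := vdirD [seq Upsilon sigma t x | t <- l] (Upsilon sigma u) x.

Definition grad u y : 'M[R]_n := \matrix_(i, j) partial i (fun z => Upsilon sigma u z 0 j) y.

Lemma lie_grad v u y : lie v (Upsilon sigma u) y = v *m grad u y.
Proof. by apply/rowP => j; rewrite !mxE; apply: eq_bigr => i _; rewrite mxE. Qed.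

Lemma jet0 u x : jet [::] u x = Upsilon sigma u x.
Proof. by apply/rowP => j; rewrite mxE. Qed.

Lemma jet_gograft_rec l u x : (seq_size l + tree_size u <= N)%N ->
  jet l u x = Upsilon_lin sigma (gograft_rec (size l) l u) x.
Proof. by move=> lN; rewrite (Upsilon_gograft_rec sigmaC _ (erefl _)). Qed.

Lemma Upsilon_smooth_le k u : (k + tree_size u <= N)%N -> vsmooth k (Upsilon sigma u).
Proof.
move=> kN j; have uN := leq_trans (leq_addl _ _) kN.
by apply: smooth_le (Upsilon_smooth sigmaC uN j); rewrite leq_subRL// addnC.
Qed.

Lemma jet_perm l l' u x : (seq_size l + tree_size u <= N)%N -> perm_eq l l' ->
  jet l u x = jet l' u x.
Proof.
move=> lN ll'; apply/rowP => j; rewrite !mxE; apply: dirD_perm; last exact: perm_map.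
rewrite size_map; apply: Upsilon_smooth_le; rewrite (leq_trans _ lN)// leq_add2r.
exact: size_seq_size.
Qed.

(** Grafting [l] onto a graft: each tree of [l] goes onto [t] or, beside [t], onto [u]. It is
    [dirD_grad] applied to the derivative of [Upsilon sigma u] along [Upsilon sigma t]. *)
Lemma jet_graft l t u x : (seq_size l + (tree_size t + tree_size u) <= N)%N ->
  \sum_(r <- dom (graft t u)) (coeff r (graft t u))%:~R *: jet l r x =
  \sum_(s <- splits l) \sum_(r <- dom (gograft_rec (size s.1) s.1 t))
    (coeff r (gograft_rec (size s.1) s.1 t))%:~R *: jet (r :: s.2) u x.
Proof.
move=> lN; have szl := size_seq_size l.
have tuN := leq_trans (leq_addl _ _) lN.
have lN' : (size l + (tree_size t + tree_size u) <= N)%N.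
  by rewrite (leq_trans _ lN)// leq_add2r.
apply/rowP => j; rewrite !summxE.
transitivity (dirD [seq Upsilon sigma a x | a <- l]
    (fun y => Upsilon_lin sigma (graft t u) y 0 j) x).
  rewrite (dirD_Upsilon_lin sigmaC) => [|r /homogeneous_graft ->]; last first.
    by rewrite size_map addnC.
  by apply: eq_bigr => r _; rewrite !mxE.
have -> : (fun y => Upsilon_lin sigma (graft t u) y 0 j) =
    fun y => \sum_i Upsilon sigma t y 0 i * partial i (fun z => Upsilon sigma u z 0 j) y.
  by apply/funext => y; rewrite (Upsilon_lin_graft sigmaC)// mxE.
have st : vsmooth (size [seq Upsilon sigma a x | a <- l]) (Upsilon sigma t).
  by apply: Upsilon_smooth_le; rewrite size_map; lia.
have su : smooth (size [seq Upsilon sigma a x | a <- l]).+1 (fun z => Upsilon sigma u z 0 j).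
  by apply: Upsilon_smooth_le; rewrite size_map; have := tree_size_gt0 t; lia.
rewrite (dirD_grad _ st su) splits_map big_map; apply: eq_big_seq => s sl; rewrite summxE /=.
have ss := seq_size_splits sl.
rewrite -/(jet s.1 t x) jet_gograft_rec; last by lia.
rewrite {1}/Upsilon_lin; under eq_bigr do rewrite summxE mulr_suml.
rewrite exchange_big/=; apply: eq_bigr => r _; rewrite mxE mxE/= mulr_sumr.
by apply: eq_bigr => i _; rewrite mxE mulrA.
Qed.

(** The Lipschitz constant bounds the partial derivatives, which exist because fewer than [N]
    vertices leave one order of smoothness. *)
Lemma grad_bound u : (tree_size u < N)%N -> exists C : R, forall y, `|grad u y| <= C.
Proof.
move=> uN; have [L fL] := UpsilonL (ltnW uN).
have su j : smooth 1 (fun z => Upsilon sigma u z 0 j) by apply: Upsilon_smooth_le; lia.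
exists `|L| => y; apply: norm_mx_le => // i j; rewrite mxE.
have dU : derivable (Upsilon sigma u) y 'e_i.
  by apply/derivable_mxP => a c; rewrite ord1; exact: smooth_derivable (su c).
have -> : partial i (fun z => Upsilon sigma u z 0 j) y = ('D_('e_i) (Upsilon sigma u) y) 0 j.
  by rewrite derive_mx// mxE.
rewrite (le_trans (norm_coord_le _ _ _))// (le_trans (derive_lipschitz fL dU))//.
rewrite (le_trans (ler_wpM2r _ (ler_norm L)))// ler_piMr//.
exact: norm_basis_le.
Qed.

(* Up to sign, the remainder after replacing [x + th *: dl] by the formal point
   [x + th *: \sum_t X_t U_t] in [Upsilon u], resp. in [Upsilon t x *m grad u]. *)
Definition remD (th : R) x dl u l : 'rV[R]_n :=
  th ^+ size l *: jet l u x - (if l is [::] then Upsilon sigma u (x + th *: dl) else 0).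

Definition remQ (th : R) x dl t u l : 'rV[R]_n :=
  th ^+ size l *: jet (t :: l) u x -
  (if l is [::] then Upsilon sigma t x *m grad u (x + th *: dl) else 0).

(** Uniformity in [th] is what allows averaging over the interpolation parameter. *)
Definition boundedD M u : Prop := exists C : R, forall th x dl, 0 <= th <= 1 ->
  expandable (fun t => Upsilon sigma t x) dl M C (remD th x dl u).

Definition boundedQ M t u : Prop := exists C : R, forall th x dl, 0 <= th <= 1 ->
  expandable (fun t => Upsilon sigma t x) dl M C (remQ th x dl t u).

Lemma boundedD0 u : (tree_size u <= N)%N -> boundedD 0 u.
Proof.
move=> uN; have [L fL] := UpsilonL uN.
exists `|L| => th x dl /andP[th0 th1]; apply: expandable_order0 => //.
rewrite /remD /= expr0 scale1r jet0.
apply: le_trans (fL (x, x + th *: dl) _) _ => //=.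
rewrite opprD addrA subrr sub0r normrN normrZ ger0_norm//.
rewrite (le_trans (ler_wpM2r _ (ler_norm L)))// ?mulr_ge0//.
by rewrite ler_wpM2l// ler_piMl.
Qed.

Lemma mean_path L u x v j : is_mean L -> (tree_size u < N)%N ->
  L (fun r : R => - (v *m grad u (x + r *: v)) 0 j) =
  Upsilon sigma u x 0 j - Upsilon sigma u (x + v) 0 j.
Proof.
move=> [_ _ Lder] uN; set f := fun z => Upsilon sigma u z 0 j.
have sf : smooth 1 f by apply: Upsilon_smooth_le; lia.
have der (r : R) : is_derive r (1 : R) (fun r : R => - f (x + r *: v))
    (- (v *m grad u (x + r *: v)) 0 j).
  rewrite mxE; under eq_bigr do rewrite mxE.
  have := is_derive_path x v r sf; exact: is_deriveN.
rewrite (Lder _ _ der); first by rewrite scale1r scale0r addr0 opprK addrC.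
move=> r; apply: continuousN.
  have -> : (fun r : R => (v *m grad u (x + r *: v)) 0 j) =
      fun r : R => \sum_i v 0 i * partial i f (x + r *: v).
    by apply/funext => q; rewrite mxE; apply: eq_bigr => i _; rewrite mxE.
  have cline : continuous (fun r : R => x + r *: v).
    move=> q; apply: (@continuousD _ _ _ (cst x) (fun r : R => r *: v)).
      exact: cst_continuous.
    exact: scalel_continuous.
  have csum (s : seq 'I_n) :
      continuous (fun r : R => \sum_(i <- s) v 0 i * partial i f (x + r *: v)).
    elim: s => [|i s IH].
      under [X in continuous X]funext do rewrite big_nil.
      exact: cst_continuous.
    under [X in continuous X]funext do rewrite big_cons.
    move=> q; apply: (@continuousD _ _ _ (fun r : R => v 0 i * partial i f (x + r *: v))
      (fun r : R => \sum_(k <- s) v 0 k * partial k f (x + r *: v))); last exact: IH.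
    apply: (@continuousM _ _ (cst (v 0 i)) (fun r : R => partial i f (x + r *: v))).
      exact: cst_continuous.
    apply: (@continuous_comp _ _ _ (fun r : R => x + r *: v) (partial i f)).
      exact: cline.
    exact: (smooth_continuous (smooth_partial i sf)).
  exact: csum.
Qed.

(** With [V = \sum_t X_t U_t], the derivative of the remainder at scale [th * et] in [et] is [th]
    times the sum of the generator [V - dl] applied to the gradient at [x + (th * et) *: dl] and of
    the series [X_t remQ t u], of order lowered by [tree_size t]. The mean over [et] recovers
    [remD]. *)
Lemma boundedD_step M u : (0 < M)%N -> (tree_size u + M <= N)%N ->
  (forall t, (tree_size t <= M)%N -> boundedQ (M - tree_size t) t u) -> boundedD M u.
Proof.
move=> M0 uM Q; have uN : (tree_size u < N)%N by lia.
have [G gradG] := grad_bound uN; have [L meanL] := exists_mean R.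
have [C C0 CP] : exists2 C : R, 0 <= C & forall t, (tree_size t <= M)%N ->
    forall th x dl, 0 <= th <= 1 ->
    expandable (fun t => Upsilon sigma t x) dl (M - tree_size t) C (remQ th x dl t u).
  apply: (finite_uniform_bound (finite_trees d M) _ Q) => t C D CD CP th x dl th01.
  exact: expandable_le CD (CP th x dl th01).
exists (G + 2 ^+ M * C) => th x dl th01.
pose b (et : R) l := th *: ((match l with
    [::] => - (dl *m grad u (x + (th * et) *: dl))
  | [:: a] => Upsilon sigma a x *m grad u (x + (th * et) *: dl)
  | _ => 0 end) + \sum_(s <- removals l) remQ (th * et) x dl s.1 u s.2).
(* On one entry the gradient terms cancel; on longer lists all removals give the same jet by
   symmetry, whence the factor [size l]. *)
have bE l (et : R) : (0 < size l)%N -> (seq_size l <= M)%N ->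
    b et l = (size l)%:R *: (th ^+ size l *: (et ^+ (size l).-1 *: jet l u x)).
  case: l => [//|a [_ _|c l _ lM]].
    rewrite /b /= big_seq1 /remQ /= expr0 !scale1r expr1; congr (_ *: _).
    by rewrite addrC subrK.
  rewrite /b add0r; set l' := a :: c :: l; rewrite big_seq.
  rewrite (eq_bigr (fun=> (th * et) ^+ (size l').-1 *: jet l' u x)); last first.
    move=> s /perm_removals sl; have := perm_size sl => -[ss].
    have -> : (size l').-1 = size s.2 by rewrite /= ss.
    rewrite /remQ; have -> : jet (s.1 :: s.2) u x = jet l' u x.
      by apply: (jet_perm _ _ sl); rewrite (seq_size_perm sl) (leq_trans _ uM)// addnC leq_add2l.
    by case: s.2 ss => [//|e r] ss; rewrite subr0.
  rewrite -big_seq big_const_seq count_predT iter_addr addr0 size_removals.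
  rewrite -scaler_nat !scalerA; congr (_ *: _).
  rewrite [size l']/= [_.-1]/= exprMn [th ^+ (_.+2)]exprS; ring.
have bD et : 0 <= et <= 1 ->
    expandable (fun t => Upsilon sigma t x) dl M (G + 2 ^+ M * C) (b et).
  move=> et01; have tet01 : 0 <= th * et <= 1.
    move: th01 et01 => /andP[th0 th1] /andP[et0 et1].
    by rewrite mulr_ge0//= mulr_ile1.
  have bd := expandableD
    (expandable_generator (fun t => Upsilon sigma t x) dl M (grad u (x + (th * et) *: dl)))
    (expandable_removals C0 (fun a aM => CP a aM _ x dl tet01)).
  apply: expandable_le (expandableZ th bd).
  move: th01 => /andP[th0 th1]; rewrite ger0_norm// -[leRHS]mul1r.
  by rewrite ler_pM ?addr_ge0 ?mulr_ge0 ?exprn_ge0// lerD.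
(* The mean is evaluated by [mean_path] on the empty list and by [mean_monomial] on the others. *)
apply: expandable_ext (expandable_mean meanL bD) => -[|a l] lM; apply/rowP => j; rewrite mxE.
  have -> : (fun et => b et [::] 0 j) =
      fun et => - ((th *: dl) *m grad u (x + et *: (th *: dl))) 0 j.
    apply/funext => et; rewrite /b big_nil addr0 scalerN mxE -scalemxAl scalerA.
    by rewrite [et * th]mulrC.
  by rewrite (mean_path _ _ _ meanL uN) /remD /= expr0 scale1r jet0 !mxE.
have -> : (fun et => b et (a :: l) 0 j) =
    fun et => (size l).+1%:R * (th ^+ (size l).+1 * jet (a :: l) u x 0 j) * et ^+ size l.
  by apply/funext => et; rewrite bE// !scalerA mxE /=; ring.
by rewrite (mean_monomial _ _ meanL) /remD subr0 [RHS]mxE.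
Qed.

(** The first two terms combine into the series of [Upsilon sigma t] at the formal point times the
    gradient difference of [Upsilon sigma u]. The constant term of that series gives [remQ t u]; the
    others, with a nonempty forest grafted on [t], are subtracted by the last sum. *)
Lemma remQ_decomposition M th x dl t u l :
  (tree_size t + tree_size u + M <= N)%N -> (seq_size l <= M)%N ->
  remQ th x dl t u l =
  (\sum_(r <- dom (graft t u)) (coeff r (graft t u))%:~R *: remD th x dl r l
   - remD th x dl t l *m grad u (x + th *: dl))
  - \sum_(s <- splits l) (if s.1 is [::] then 0 else
      th ^+ size s.1 *: \sum_(r <- dom (gograft_rec (size s.1) s.1 t))
        (coeff r (gograft_rec (size s.1) s.1 t))%:~R *: remQ th x dl r u s.2).
Proof.
move=> tuM lM; set A := grad u (x + th *: dl); set y := x + th *: dl.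
pose Z (s : seq (tree d) * seq (tree d)) : 'rV[R]_n :=
  \sum_(r <- dom (gograft_rec (size s.1) s.1 t))
    (coeff r (gograft_rec (size s.1) s.1 t))%:~R *: jet (r :: s.2) u x.
have ZE : \sum_(r <- dom (graft t u)) (coeff r (graft t u))%:~R *: remD th x dl r l =
    th ^+ size l *: (jet (t :: l) u x + \sum_(s <- splits l) (if s.1 is [::] then 0 else Z s))
    - (if l is [::] then Upsilon sigma t y *m A else 0).
  have -> : jet (t :: l) u x + \sum_(s <- splits l) (if s.1 is [::] then 0 else Z s) =
      \sum_(r <- dom (graft t u)) (coeff r (graft t u))%:~R *: jet l r x.
    rewrite jet_graft; last by lia.
    rewrite (sum_splits_nil_l (fun p q => Z (p, q))); congr (_ + _).
    by rewrite /Z /= domU1 big_seq1 coeffU eqxx mulr1 scale1r.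
  rewrite scaler_sumr; under eq_bigr do rewrite /remD scalerBr scalerA mulrC -scalerA.
  rewrite sumrB; congr (_ - _); case: (l) => [|a l'].
    by rewrite -lie_grad -(Upsilon_lin_graft sigmaC)//; lia.
  by rewrite big1// => r _; rewrite scaler0.
(* The gradient at [y] enters only when the second part is empty. *)
have QE (s : seq (tree d) * seq (tree d)) : s \in splits l ->
    th ^+ size s.1 *: \sum_(r <- dom (gograft_rec (size s.1) s.1 t))
        (coeff r (gograft_rec (size s.1) s.1 t))%:~R *: remQ th x dl r u s.2 =
    th ^+ size l *: Z s - (if s.2 is [::] then th ^+ size s.1 *: (jet s.1 t x *m A) else 0).
  move=> sl; have := perm_size (perm_splits sl); rewrite size_cat => <-.
  have s1M : (seq_size s.1 <= M)%N by rewrite (leq_trans _ lM)// -(seq_size_splits sl) leq_addr.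
  under eq_bigr do rewrite /remQ scalerBr.
  rewrite sumrB scalerBr; congr (_ - _).
    rewrite exprD -[RHS]scalerA [in RHS]scaler_sumr; congr (_ *: _).
    by apply: eq_bigr => r _; rewrite !scalerA mulrC.
  case: s.2 => [|a q]; last by rewrite big1 ?scaler0// => r _; rewrite scaler0.
  congr (_ *: _); rewrite jet_gograft_rec; last by lia.
  rewrite /Upsilon_lin mulmx_suml.
  by apply: eq_bigr => r _; rewrite scalemxAl.
(* These gradient terms collapse to [G l], which cancels the jet part of [remD t] times [A] on
   nonempty lists. *)
pose G p : 'rV[R]_n := if p is [::] then 0 else th ^+ size p *: (jet p t x *m A).
have -> : \sum_(s <- splits l) (if s.1 is [::] then 0 else
      th ^+ size s.1 *: \sum_(r <- dom (gograft_rec (size s.1) s.1 t))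
        (coeff r (gograft_rec (size s.1) s.1 t))%:~R *: remQ th x dl r u s.2) =
    th ^+ size l *: (\sum_(s <- splits l) (if s.1 is [::] then 0 else Z s)) - G l.
  rewrite -[G l](sum_splits_nil_r G) scaler_sumr -sumrB; apply: eq_big_seq => s sl.
  have := QE s sl; case: (s.1) => [_|a p ->].
    by rewrite scaler0 sub0r; case: s.2 => [|? ?]; rewrite oppr0.
  by congr (_ - _); case: s.2.
rewrite ZE scalerDr; move: (th ^+ size l *: \sum_(s <- splits l) _) => S.
rewrite /remD /remQ /G; case: (l) => [|a l'].
  rewrite /= expr0 !scale1r jet0 mulmxBl -/y opprB.
  move: (jet _ _ _) (_ *m A) (_ *m A) => a b c.
  by rewrite subr0 addrA subrK addrAC addrK.
rewrite !subr0 -scalemxAl.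
move: (_ *: jet _ _ _) (_ *: (_ *m A)) => a' b.
by rewrite opprB addrA subrK addrK.
Qed.

(** In [remQ_decomposition] the terms in [remD] have the same order and a bounded matrix factor; in
    the sum a nonempty [p] enlarges the tree by [seq_size p] and lowers the order by as much, so the
    budget [N] is respected. *)
Lemma boundedQ_step M t u : (tree_size t + tree_size u + M <= N)%N ->
  (forall r, (tree_size r + M <= N)%N -> boundedD M r) ->
  (forall k r, (k < M)%N -> (tree_size r + tree_size u + k <= N)%N -> boundedQ k r u) ->
  boundedQ M t u.
Proof.
move=> tuM D Q.
have [G gradG] : exists G : R, forall y, `|grad u y| <= G.
  by apply: grad_bound; have := tree_size_gt0 t; lia.
have [C1 C10 C1P] : exists2 C : R, 0 <= C & forall r, r \in t :: dom (graft t u) ->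
    forall th x dl, 0 <= th <= 1 ->
    expandable (fun t => Upsilon sigma t x) dl M C (remD th x dl r).
  apply: (@seq_uniform_bound _ _ (fun r C => forall th x dl, 0 <= th <= 1 ->
    expandable (fun t => Upsilon sigma t x) dl M C (remD th x dl r))).
    by move=> r C C' CC' CP th x dl th01; exact: expandable_le CC' (CP th x dl th01).
  move=> r; rewrite in_cons => /predU1P[->|/homogeneous_graft rE]; apply: D; lia.
pose b th x dl p l : 'rV[R]_n := if p is [::] then 0 else
  th ^+ size p *: \sum_(r <- dom (gograft_rec (size p) p t))
    (coeff r (gograft_rec (size p) p t))%:~R *: remQ th x dl r u l.
have [C2 C20 C2P] : exists2 C : R, 0 <= C & forall p, (seq_size p <= M)%N ->
    forall th x dl, 0 <= th <= 1 ->
    expandable (fun t => Upsilon sigma t x) dl (M - seq_size p) C (b th x dl p).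
  apply: (@finite_uniform_bound _ _ (fun p C => forall th x dl, 0 <= th <= 1 ->
    expandable (fun t => Upsilon sigma t x) dl (M - seq_size p) C (b th x dl p)) _
    (finite_tree_seqs d M)).
    by move=> r C C' CC' CP th x dl th01; exact: expandable_le CC' (CP th x dl th01).
  move=> [_|a p pM]; first by exists 0 => th x dl _; exact: expandable0.
  have sp : (0 < seq_size (a :: p))%N.
    by rewrite /seq_size/=; have := tree_size_gt0 a; lia.
  set g := gograft_rec (size (a :: p)) (a :: p) t.
  have [C C0 CP] : exists2 C : R, 0 <= C & forall r, r \in dom g ->
      forall th x dl, 0 <= th <= 1 ->
      expandable (fun t => Upsilon sigma t x) dl (M - seq_size (a :: p)) C (remQ th x dl r u).
    apply: (@seq_uniform_bound _ _ (fun r C => forall th x dl, 0 <= th <= 1 ->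
      expandable (fun t => Upsilon sigma t x) dl (M - seq_size (a :: p)) C (remQ th x dl r u))).
      by move=> r C C' CC' CP th x dl th01; exact: expandable_le CC' (CP th x dl th01).
    move=> r /(homogeneous_gograft (erefl _)) rE.
    have pM' : (seq_size (a :: p) <= M)%N := pM.
    by apply: Q; rewrite ?rE; lia.
  exists (\sum_(r <- dom g) `|(coeff r g)%:~R| * C) => th x dl th01.
  apply: expandable_le (expandableZ (th ^+ size (a :: p))
    (expandable_sum (fun r rg => expandableZ (coeff r g)%:~R (CP r rg th x dl th01)))).
  move: th01 => /andP[th0 th1].
  rewrite normrX ger0_norm// ler_piMl ?exprn_ile1//.
  by apply: sumr_ge0 => r _; rewrite mulr_ge0.
exists (\sum_(r <- dom (graft t u)) `|(coeff r (graft t u))%:~R| * C1 +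
  n%:R * (C1 * G) + 2 ^+ M * C2) => th x dl th01.
apply: (@expandable_ext _ _ _ _ _ _ _ _ _ (fun l lM => esym (remQ_decomposition th x dl tuM lM))).
apply: expandableB; last first.
  apply: (expandable_split C20 (b := b th x dl)) => p pM.
  exact: C2P.
apply: expandableB.
  apply: expandable_sum => r rg; apply: expandableZ; apply: C1P => //.
  by rewrite in_cons rg orbT.
apply: expandable_le (expandable_mulmx _ (C1P t (mem_head _ _) th x dl th01)).
by rewrite ler_wpM2l// ler_wpM2l.
Qed.

(** Strong induction: [remD] at order [M] needs [remQ] at orders [M - tree_size t], smaller since
    trees are nonempty; [remQ] at order [M] then needs [remD] at order [M] and [remQ] below. *)
Theorem bounded_remainders M :
  (forall u, (tree_size u + M <= N)%N -> boundedD M u) /\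
  (forall t u, (tree_size t + tree_size u + M <= N)%N -> boundedQ M t u).
Proof.
elim/ltn_ind: M => M IH.
have D u : (tree_size u + M <= N)%N -> boundedD M u.
  move=> uM; have [M0|M0] := posnP M.
    by rewrite M0; apply: boundedD0; lia.
  apply: boundedD_step => // t tM; have t0 := tree_size_gt0 t.
  have [|_ Q] := IH (M - tree_size t)%N; first by lia.
  by apply: Q; lia.
split=> // t u tuM; apply: boundedQ_step => // k r kM rk.
by have [_ Q] := IH k kM; exact: Q.
Qed.

End MainEstimate.

(** * From lists to forests *)

Lemma fsbig_pred (T : choiceType) (V : nmodType) (P : pred T) (s : seq T) (F : T -> V) :
  uniq s -> (forall a, P a -> a \in s) ->
  \sum_(a \in [set a | P a]) F a = \sum_(a <- s | P a) F a.
Proof.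
move=> us Ps; rewrite (fsbigE [seq a <- s | P a]) ?filter_uniq//=.
- rewrite big_filter_cond; apply: eq_bigl => a.
  by apply: andb_idr => Pa; rewrite mem_setE.
- by move=> a /=; rewrite mem_filter => /andP[].
- by move=> a /= Pa; rewrite mem_filter Pa Ps.
Qed.

Section Assembly.
Variables (R : realType) (n d : nat).
Implicit Types (w : forest d) (r t a : tree d).

Definition forests_upto (m : nat) : seq (forest d) :=
  fset_set [set w : forest d | (forest_size w <= m)%N].

Definition trees_upto (m : nat) : seq (tree d) :=
  fset_set [set t : tree d | (tree_size t <= m)%N].

Lemma mem_forests_upto m w : (w \in forests_upto m) = (forest_size w <= m)%N.
Proof. by rewrite in_fset_set ?mem_setE//; exact: finite_forests. Qed.

Lemma mem_trees_upto m r : (r \in trees_upto m) = (tree_size r <= m)%N.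
Proof. by rewrite in_fset_set ?mem_setE//; exact: finite_trees. Qed.

Lemma forest_size_rem a w : a \in w -> forest_size w = (tree_size a + forest_size (w `\ a)%mset)%N.
Proof. by move=> aw; rewrite -forest_sizeD1 msetB1K. Qed.

Lemma reindex_removal (V : nmodType) m a (G : forest d -> V) :
  \sum_(w <- forests_upto m | a \in w) G w =
  \sum_(w <- forests_upto m | (tree_size a + forest_size w <= m)%N) G (a +` w).
Proof.
rewrite -big_filter -[RHS]big_filter -(big_map (fun w => a +` w) xpredT G).
apply: perm_big; apply: uniq_perm.
- exact/filter_uniq/fset_uniq.
- rewrite map_inj_uniq; first exact/filter_uniq/fset_uniq.
  by move=> w w' /(congr1 (fun u => (u `\ a)%mset)); rewrite !msetD1K.
move=> w; rewrite mem_filter mem_forests_upto; apply/andP/mapP => [[aw wm]|[w' + ->]].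
  exists (w `\ a)%mset; last by rewrite msetB1K.
  rewrite mem_filter mem_forests_upto -(forest_size_rem aw) wm/=.
  by rewrite (leq_trans _ wm)// (forest_size_rem aw) leq_addl.
by rewrite mem_filter => /andP[w'm _]; rewrite mset1D1 forest_sizeD1.
Qed.

(** Insert the recursion for [dl *m H w]. The terms with one tree removed, reindexed by the smaller
    forest, cancel the inner tree sum by multiplicativity of [X]; only the [c w] survive. *)
Lemma expansion_identity m (X : forest d -> R) (U : tree d -> 'rV[R]_n) (dl : 'rV[R]_n)
    (H : forest d -> 'M[R]_n) (c : forest d -> 'rV[R]_n) :
  (forall r w, (tree_size r + forest_size w <= m)%N -> X (r +` w) = X [mset r]%mset * X w) ->
  (forall w, (forest_size w <= m)%N ->
     dl *m H w = \sum_(a <- finsupp w) U a *m H (w `\ a)%mset - c w) ->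
  \sum_(w \in [set w : forest d | (forest_size w <= m)%N])
    X w *: ((dl - \sum_(r \in [set r : tree d | (tree_size r < m.+1 - forest_size w)%N])
      X [mset r]%mset *: U r) *m H w) =
  - \sum_(w \in [set w : forest d | (forest_size w <= m)%N]) X w *: c w.
Proof.
move=> Xmul HE.
have big_forests (G : forest d -> 'rV[R]_n) :
    \sum_(w \in [set w : forest d | (forest_size w <= m)%N]) G w =
    \sum_(w <- forests_upto m | (forest_size w <= m)%N) G w.
  by apply: fsbig_pred => [|w wm]; [exact: fset_uniq|rewrite mem_forests_upto].
rewrite !big_forests.
transitivity (\sum_(w <- forests_upto m | (forest_size w <= m)%N)
    ((\sum_(a <- trees_upto m | a \in w) X w *: (U a *m H (w `\ a)%mset) - X w *: c w) -
     \sum_(r <- trees_upto m | (tree_size r + forest_size w <= m)%N)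
       X [mset r]%mset * X w *: (U r *m H w))).
  apply: eq_bigr => w wm; rewrite mulmxBl scalerBr HE// scalerBr.
  have -> : X w *: \sum_(a <- finsupp w) U a *m H (w `\ a)%mset =
      \sum_(a <- trees_upto m | a \in w) X w *: (U a *m H (w `\ a)%mset).
    rewrite scaler_sumr -[RHS]big_filter; apply: perm_big; apply: uniq_perm.
    - exact: fset_uniq.
    - exact/filter_uniq/fset_uniq.
    move=> a; rewrite msuppE mem_filter mem_trees_upto; symmetry; apply: andb_idr => aw.
    by rewrite (leq_trans _ wm)// (forest_size_rem aw) leq_addr.
  (* The strict bound with [m.+1] means that [r] and [w] together have at most [m] vertices. *)
  have -> // : X w *: ((\sum_(r \in [set r : tree d | (tree_size r < m.+1 - forest_size w)%N])
        X [mset r]%mset *: U r) *m H w) =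
      \sum_(r <- trees_upto m | (tree_size r + forest_size w <= m)%N)
        X [mset r]%mset * X w *: (U r *m H w).
  rewrite (@fsbig_pred _ _ (fun r => tree_size r < m.+1 - forest_size w)%N (trees_upto m)).
  - rewrite mulmx_suml scaler_sumr; apply: eq_big => [r|r _]; first by lia.
    by rewrite -scalemxAl scalerA mulrC.
  - exact: fset_uniq.
  - by move=> r; rewrite mem_trees_upto; lia.
rewrite sumrB sumrB addrAC -[RHS]add0r; congr (_ - _); apply/eqP; rewrite subr_eq0; apply/eqP.
rewrite -!(big_filter _ (fun w => forest_size w <= m)%N).
have fall : [seq w <- forests_upto m | (forest_size w <= m)%N] = forests_upto m.
  by apply/all_filterP/allP => w; rewrite mem_forests_upto.
rewrite fall (exchange_big_dep xpredT)//= [RHS](exchange_big_dep xpredT)//=.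
apply: eq_bigr => a _; rewrite reindex_removal; apply: eq_bigr => w aw.
by rewrite Xmul// msetD1K.
Qed.

Lemma forest_sym_rem a w : a \in w -> forest_sym w = (w a * forest_sym (w `\ a)%mset)%N.
Proof.
(* Both products can run over the support of [w], absent trees contributing [0! = 1]. *)
move=> aw; have symE w' : {subset finsupp w' <= finsupp w} ->
    forest_sym w' = (\prod_(t <- finsupp w) (w' t)`!)%N.
  move=> ww'; rewrite /forest_sym [RHS](bigID (mem (finsupp w')))/= [X in (_ * X)%N]big1 ?muln1.
    rewrite -[RHS]big_filter; apply: perm_big; apply: uniq_perm.
    - exact: fset_uniq.
    - exact/filter_uniq/fset_uniq.
    by move=> t; rewrite mem_filter; case: (boolP (t \in finsupp w')) => // /ww' ->.
  by move=> t; rewrite msuppE => /mset_eq0P ->.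
rewrite !symE//; last first.
  by move=> t; rewrite !msuppE; apply: msubset_subset; exact: msubD1set.
have aw' : a \in (finsupp w : seq _) by rewrite msuppE.
rewrite (bigD1_seq a aw' (fset_uniq _))/= [in RHS](bigD1_seq a aw' (fset_uniq _))/= mulnA; congr (_ * _)%N.
  by rewrite msetB1E eqxx subn1; move: aw; rewrite -mset_gt0; case: (w a) => // k _; rewrite factS.
by apply: eq_bigr => t ta; rewrite msetB1E (negbTE ta) subn0.
Qed.

Lemma forest_sym_gt0 w : (0 < forest_sym w)%N.
Proof. by rewrite /forest_sym; apply: prodn_gt0 => t; exact: fact_gt0. Qed.

Definition tree_le : rel (tree d) := fun t r => ptree_le (val t) (val r).

(* A sorted list stays sorted when a tree is removed, so that coefficients indexed
   by lists restrict consistently to forests. *)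
Definition sorted_seq w : seq (tree d) := sort tree_le w.

Lemma tree_le_trans : transitive tree_le.
Proof. by move=> t r u; exact: ptree_le_trans. Qed.

Lemma tree_le_total : total tree_le.
Proof. by move=> t r; exact: ptree_le_total. Qed.

Lemma tree_le_anti : antisymmetric tree_le.
Proof. by move=> t r /ptree_le_anti/val_inj. Qed.

Lemma perm_sorted_seq w : perm_eq (sorted_seq w) w.
Proof. by rewrite /sorted_seq perm_sort. Qed.

Lemma seq_size_sorted_seq w : seq_size (sorted_seq w) = forest_size w.
Proof.
by rewrite (seq_size_perm (perm_sorted_seq w)) /seq_size /forest_size sumnE big_map.
Qed.

Lemma subseq_removals (T : eqType) (l : seq T) s : s \in removals l -> subseq s.2 l.
Proof.
elim: l s => [//|b l IH] s /=; rewrite in_cons => /predU1P[->|/mapP[q /IH ql ->]].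
  exact: subseq_cons.
by rewrite /= eqxx.
Qed.

Lemma removals_sorted_seq w s : s \in removals (sorted_seq w) ->
  s.2 = sorted_seq (w `\ s.1)%mset.
Proof.
move=> sw; have srt : sorted tree_le s.2.
  apply: subseq_sorted (subseq_removals sw) _; first exact: tree_le_trans.
  exact/sort_sorted/tree_le_total.
rewrite -(sorted_sort tree_le_trans srt); apply/perm_sortP.
- exact: tree_le_total.
- exact: tree_le_trans.
- exact: tree_le_anti.
have pw : perm_eq (s.1 :: s.2) w.
  exact: perm_trans (perm_removals sw) (perm_sorted_seq w).
apply/allP => b _ /=; rewrite count_mem_mset msetB1E -(count_mem_mset b w).
by rewrite -(permP pw) /= [b == _]eq_sym addKn.
Qed.

Lemma removals_fst (T : Type) (l : seq T) : [seq s.1 | s <- removals l] = l.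
Proof. by elim: l => //= b l IH; rewrite -map_comp -[in RHS]IH. Qed.

(** Equal trees leave equal sorted lists, whence the multiplicity [w a], later absorbed by
    [forest_sym_rem]. *)
Lemma sum_removals_sorted_seq (V : nmodType) w (G : tree d -> seq (tree d) -> V) :
  \sum_(s <- removals (sorted_seq w)) G s.1 s.2 =
  \sum_(a <- finsupp w) G a (sorted_seq (w `\ a)%mset) *+ w a.
Proof.
transitivity (\sum_(s <- removals (sorted_seq w)) G s.1 (sorted_seq (w `\ s.1)%mset)).
  by apply: eq_big_seq => s /removals_sorted_seq <-.
rewrite -(big_map (fun s => s.1) xpredT (fun a => G a (sorted_seq (w `\ a)%mset))).
rewrite removals_fst (perm_big _ (perm_sorted_seq w)) big_mset.
by apply: eq_bigr => a _; rewrite Monoid.iteropE iter_addr addr0.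
Qed.

End Assembly.

(** * Positivity of the gradient product, and conclusion *)

Lemma grad_sup_ge0 (R : realType) (n : nat) (f : 'rV[R]_n -> 'rV[R]_n) : 0 <= grad_sup f.
Proof.
rewrite /grad_sup; set S := [set _ | _ in _].
(* Without a supremum, [sup] takes the default value 0. *)
have [[[y Sy] uS]|noS] := pselect (has_sup S); last by rewrite sup_out.
by apply: le_trans (ub_le_sup uS Sy); case: Sy => x _ <-.
Qed.

Lemma grad_prod_gt0 (R : realType) (n d : nat) (sigma : 'I_d -> 'rV[R]_n -> 'rV[R]_n) k :
  0 < grad_prod sigma k.
Proof.
rewrite /grad_prod; set A := [set t | _].
have fA : finite_set A by apply: sub_finite_set (finite_trees d k) => t [].
rewrite fsbig_finite// big_seq; apply: prodr_gt0 => t.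
rewrite in_fset_set// => /set_mem[_ t0].
by rewrite lt_neqAle eq_sym t0 grad_sup_ge0.
Qed.

Lemma brp_cons (R : realType) (d N : nat) (alpha T : R) (XX : R -> R -> forest d -> R) s t
    (r : tree d) (w : forest d) :
  branched_rough_path alpha N T XX -> 0 <= s -> s <= t -> t <= T ->
  (tree_size r + forest_size w <= N)%N ->
  XX s t (r +` w) = XX s t [mset r]%mset * XX s t w.
Proof.
move=> brp s0 st tT rwN; have mul := brp_mul brp s0 st tT.
rewrite mul ?forest_sizeD1// (mul w); last exact: leq_trans (leq_addl _ _) rwN.
transitivity (\prod_(q <- r :: (w : seq (tree d))) XX s t [mset q]%mset).
  by apply: perm_big; apply/eq_seq_msetP; rewrite mset_cons !seq_mset_id.
by rewrite big_cons.
Qed.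

(* Vectors are rows, as for 'J : the matrix H acts on z by z *m H. *)
Theorem theorem1p3 (R : realType) (alpha : R) (N n d : nat)
    (sigma : 'I_d -> 'rV[R]_n -> 'rV[R]_n) :
  0 < alpha -> alpha <= 1 -> N%:Z = Num.floor alpha^-1 ->
  (forall i, Ck N.-1 (sigma i)) ->
  (forall r : tree d, (tree_size r <= N)%N ->
     exists L : R, L.-lipschitz (Upsilon sigma r)) ->
  exists c : R,
  forall (T : R) (X : R -> 'rV[R]_d) (XX : R -> R -> forest d -> R)
    (Z : R -> 'rV[R]_n),
  0 < T -> holder alpha T X ->
  branched_rough_path alpha N T XX -> is_lift T X XX ->
  davie_solution sigma N T XX Z ->
  forall t0 : tree d, (tree_size t0 <= N)%N ->
  exists H : R -> R -> forest d -> 'M[R]_n,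
    (forall s t, 0 <= s -> s <= t -> t <= T ->
     forall m : nat, (m <= N - tree_size t0)%N ->
       B_rem sigma XX Z t0 m.+1 s t =
       \sum_(w \in [set w : forest d | (forest_size w <= m)%N])
         XX s t w *: (sol_rem sigma XX Z (m.+1 - forest_size w)%N s t *m H s t w)) /\
    (forall s t, 0 <= s -> s <= t -> t <= T ->
     forall w : forest d, (forest_size w <= N - tree_size t0)%N ->
       `|H s t w| <= c * grad_prod sigma (forest_size w + tree_size t0)%N).
Proof.
move=> _ _ _ sigmaC UpsilonL.
(* Finitely many trees [t0] share one constant, fixed before the path and the solution. *)
have [C C0 CP] : exists2 C : R, 0 <= C & forall t0 : tree d, (tree_size t0 <= N)%N ->
    forall th x dl, 0 <= th <= 1 ->
    expandable (fun t => Upsilon sigma t x) dl (N - tree_size t0) C (remD sigma th x dl t0).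
  apply: (@finite_uniform_bound _ _ (fun t0 C => forall th x dl, 0 <= th <= 1 ->
    expandable (fun t => Upsilon sigma t x) dl (N - tree_size t0) C (remD sigma th x dl t0))
    _ (finite_trees d N)) => [t0 C D CD CP th x dl th01|t0 t0N].
    exact: expandable_le CD (CP th x dl th01).
  have [D _] := bounded_remainders sigmaC UpsilonL (N - tree_size t0).
  by apply: D; rewrite subnKC.
(* The products are positive, so this sum dominates [C / grad_prod sigma k] for each [k] up to
   [N]. *)
exists (\sum_(k < N.+1) C / grad_prod sigma k) => T X XX Z _ _ brp _ _ t0 t0N.
have K1 : 0 <= (1 : R) <= 1 by rewrite ler01 lexx.
(* At [th = 1] the actual point [x + dl] is [Z t]. *)
pose K s t := sval (cid (CP t0 t0N 1 (Z s) (Z t - Z s) K1)).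
have KP s t l : (seq_size l <= N - tree_size t0)%N -> `|K s t l| <= C /\
    (Z t - Z s) *m K s t l = \sum_(q <- removals l) Upsilon sigma q.1 (Z s) *m K s t q.2 -
      remD sigma 1 (Z s) (Z t - Z s) t0 l.
  exact: (svalP (cid (CP t0 t0N 1 (Z s) (Z t - Z s) K1))).
(* Division by the symmetry factor passes from exponential coefficients over lists to coefficients
   over forests. *)
exists (fun s t w => (forest_sym w)%:R^-1 *: K s t (sorted_seq w)).
have sym0 (w : forest d) : (forest_sym w)%:R != 0 :> R.
  by rewrite pnatr_eq0 -lt0n forest_sym_gt0.
split=> s t s0 st tT; last first.
  move=> w wN; have [|KC _] := KP s t (sorted_seq w); first by rewrite seq_size_sorted_seq.
  rewrite normrZ normfV normr_nat.
  have kN : (forest_size w + tree_size t0 < N.+1)%N by rewrite ltnS addnC -leq_subRL.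
  apply: (@le_trans _ _ C).
    apply: le_trans KC; rewrite ler_piMl// invf_le1 ?ltr0n ?forest_sym_gt0//.
    by rewrite ler1n forest_sym_gt0.
  rewrite (bigD1 (Ordinal kN))//= mulrDl divfK ?gt_eqF ?grad_prod_gt0// lerDl mulr_ge0//.
    by apply: sumr_ge0 => k _; rewrite divr_ge0// ltW// grad_prod_gt0.
  by rewrite ltW// grad_prod_gt0.
move=> m mN; set x := Z s; set dl := Z t - Z s.
rewrite [RHS](@expansion_identity _ _ _ m (XX s t) (fun a => Upsilon sigma a x) dl
  _ (fun w => (forest_sym w)%:R^-1 *: remD sigma 1 x dl t0 (sorted_seq w))).
- pose G (w : forest d) : 'rV[R]_n :=
    (XX s t w / (forest_sym w)%:R) *: Upsilon_lin sigma (gograft w t0) x.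
  have sumE (F : forest d -> 'rV[R]_n) (P : pred (forest d)) :
      (forall w, P w = (forest_size w <= m)%N) ->
      \sum_(w \in [set w | P w]) F w = \sum_(w <- forests_upto d m) F w.
    move=> PE; rewrite (@fsbig_pred _ _ P (forests_upto d m)).
    - by apply: big_rmcond_in => w; rewrite mem_forests_upto -PE => ->.
    - exact: fset_uniq.
    - by move=> w; rewrite mem_forests_upto -PE.
  rewrite /B_rem !sumE//.
  (* Only the empty forest carries the term [Upsilon sigma t0 (Z t)]. *)
  rewrite [X in _ = - X](eq_big_seq (fun w => G w - (if w == mset0 then Upsilon sigma t0 (Z t) else 0)))
    => [|w].
    rewrite sumrB opprB; congr (_ - _).
    rewrite (bigD1_seq mset0)/= ?fset_uniq//; last first.
      by rewrite mem_forests_upto /forest_size enum_mset0 big_nil.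
    by rewrite eqxx big1 ?addr0// => w /negbTE ->.
  rewrite mem_forests_upto => wm; rewrite scalerA /remD expr1n scale1r scalerBr.
  congr (_ - _).
    rewrite /G; congr (_ *: _); rewrite /gograft.
    have wN : (forest_size w + tree_size t0 <= N)%N by lia.
    rewrite (jet_perm sigmaC _ _ (perm_sorted_seq w)) ?seq_size_sorted_seq//.
    rewrite (jet_gograft_rec sigmaC)//.
    by rewrite -(seq_size_perm (perm_sorted_seq w)) seq_size_sorted_seq.
  have [->|w0] := eqVneq w mset0.
    rewrite /sorted_seq enum_mset0 /= (brp_one brp)// /forest_sym finsupp0 big_seq_fset0.
    by rewrite invr1 mulr1 scale1r /dl scale1r addrC subrK.
  case E : (sorted_seq w) => [|a l]; last by rewrite scaler0.
  move: w0; rewrite -size_mset_eq0 -(perm_size (perm_sorted_seq w)) E.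
  by [].
- by move=> r w rwm; apply: (brp_cons brp) => //; lia.
move=> w wm; rewrite -scalemxAr; have [|_ ->] := KP s t (sorted_seq w).
  by rewrite seq_size_sorted_seq; exact: leq_trans mN.
rewrite scalerBr; congr (_ - _); rewrite (sum_removals_sorted_seq w (fun a l => Upsilon sigma a x *m K s t l)) scaler_sumr.
apply: eq_big_seq => a; rewrite msuppE => aw.
(* The multiplicity [w a] cancels in the quotient of the symmetry factors. *)
rewrite -scalemxAr -[(_ *m _) *+ _]scaler_nat scalerA (forest_sym_rem aw) natrM invfM; congr (_ *: _).
by rewrite mulrAC mulVf ?mul1r// pnatr_eq0 mset_eq0 negbK.
Qed.
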